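(* Let $A_j,B_j$ $(1\le j\le n)$ be positive invertible bounded operators on a complex Hilbert space $\mathscr H$, and let $s,t$ be real numbers with either $1\ge t\ge s>\frac12$ or $0\le t\le s<\frac12$. Then $$\begin{aligned} &\sum_{j=1}^n(A_j\sharp_{s}B_j)\circ\sum_{j=1}^n(A_j\sharp_{1-s}B_j)\\ &\le \sum_{j=1}^n(A_j\sharp_{s}B_j)\circ\sum_{j=1}^n(A_j\sharp_{1-s}B_j)\\ &\quad+\left(\frac{t-s}{s-1/2}\right)\left(\sum_{j=1}^n(A_j\sharp_{s}B_j)\circ\sum_{j=1}^n(A_j\sharp_{1-s}B_j)-\sum_{j=1}^n(A_j\sharp B_j)\circ\sum_{j=1}^n(A_j\sharp B_j)\right)\\ &\le \sum_{j=1}^n(A_j\sharp_{t}B_j)\circ\sum_{j=1}^n(A_j\sharp_{1-t}B_j). \end{aligned}$$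
   Context: For self-adjoint bounded operators, $X\le Y$ means that $Y-X$ is positive semidefinite. For positive invertible $A,B$ and $\mu\in[0,1]$, $A\sharp_\mu B=A^{1/2}(A^{-1/2}BA^{-1/2})^{\mu}A^{1/2}$, and $\sharp=\sharp_{1/2}$. Fix an orthonormal basis $(e_j)$ of $\mathscr H$ and let $U:\mathscr H\to\mathscr H\otimes\mathscr H$ be the isometry with $Ue_j=e_j\otimes e_j$; the Hadamard product of bounded operators $X,Y$ is $X\circ Y=U^*(X\otimes Y)U$ (for matrices, the entrywise product). An expression $\sum_j X_j\circ\sum_j Y_j$ means $\bigl(\sum_j X_j\bigr)\circ\bigl(\sum_j Y_j\bigr)$. *)

(* Defs.v *)
From HB Require Import structures.
From mathcomp Require Import all_boot all_order all_algebra sesquilinear.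
From mathcomp Require Import all_classical all_reals all_analysis.
From mathcomp.real_closed Require Export complex.

Set Implicit Arguments.
Unset Strict Implicit.
Unset Printing Implicit Defensive.

Import Order.TTheory GRing.Theory Num.Theory.
Import numFieldNormedType.Exports.
Local Open Scope classical_set_scope.
Local Open Scope complex_scope.
Local Open Scope ring_scope.

(* The inner product is linear in its first argument and conjugate-linear in
   the second one. The order of R[i] is partial: 0 <= z means that z is real
   and nonnegative. *)
HB.mixin Record CompleteNormedModule_isHilbert (R : realType) (H : Type)
    of CompleteNormedModule R[i] H := {
  inner : {dot H for Num.conj} ;
  inner_norm : forall x : H, inner x x = `|x| ^+ 2 }.

#[short(type="hilbertType")]
HB.structure Definition Hilbert (R : realType) :=
  {H of CompleteNormedModule_isHilbert R H & CompleteNormedModule R[i] H}.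

Section Operators.
Context {R : realType}.

(* Operators are plain functions, so that sums, differences and scalings of
   operators are the pointwise ones and products are compositions. *)
Definition bounded_operator (H K : hilbertType R) (X : H -> K) : Prop :=
  linear X /\ continuous X.

Definition adjoint (H K : hilbertType R) (X : H -> K) : K -> H :=
  xget (fun _ => 0)
    [set Y | forall x y, inner (X x) y = inner x (Y y)].

Variable H : hilbertType R.
Implicit Types (X Y A B : H -> H).

(* Self-adjointness is not part of the definition: on a complex Hilbert space
   it follows from <X x, x> being real for every x. *)
Definition positive_op X : Prop := forall x, 0 <= inner (X x) x.

Definition op_le X Y : Prop := positive_op (Y - X).

Definition invertible_op X : Prop :=
  exists Y, [/\ bounded_operator Y, X \o Y = id & Y \o X = id].

Definition spectrum X : set R[i] :=
  [set l | ~ invertible_op (fun x => l *: x - X x)].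

Definition poly_op (p : {poly R}) X : H -> H :=
  fun x => \sum_(i < size p) (p`_i)%:C *: iter i X x.

Definition cvg_opnorm (X_ : nat -> H -> H) Y : Prop :=
  forall eps : R, 0 < eps ->
    \forall n \near \oo, forall x, `|X_ n x - Y x| <= eps%:C * `|x|.

(* Y = f(X) in the continuous functional calculus of a bounded self-adjoint
   operator X, whose spectrum is contained in the real line. *)
Definition is_functional_calculus X (f : R -> R) Y : Prop :=
  exists p : nat -> {poly R},
    {uniform [set l : R | spectrum X l%:C],
       (fun n l => (p n).[l]) @ \oo --> f} /\
    cvg_opnorm (fun n => poly_op (p n) X) Y.

Definition functional_calculus X (f : R -> R) : H -> H :=
  xget (fun _ => 0) [set Y | is_functional_calculus X f Y].

Definition op_power X (mu : R) : H -> H :=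
  functional_calculus X (fun l => l `^ mu).

Definition gmean (mu : R) A B : H -> H :=
  op_power A 2^-1
    \o op_power (op_power A (- 2^-1) \o B \o op_power A (- 2^-1)) mu
    \o op_power A 2^-1.

End Operators.

Section Hadamard.
Context {R : realType}.

Definition linear_span (H : hilbertType R) (S : set H) : set H :=
  [set v | exists (m : nat) (c : 'I_m -> R[i]) (w : 'I_m -> H),
     (forall i, S (w i)) /\ v = \sum_(i < m) c i *: w i].

Definition orthonormal_basis (H : hilbertType R) (J : Type) (e : J -> H) :
    Prop :=
  [/\ forall j, inner (e j) (e j) = 1,
      forall i j, i <> j -> inner (e i) (e j) = 0
    & closure (linear_span (range e)) = setT].

(* K together with tensor is a model of the Hilbert space tensor product of H1
   and H2; these properties determine it up to a unique unitary equivalence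
   compatible with elementary tensors. *)
Record hilbert_tensor (H1 H2 K : hilbertType R) := HilbertTensor {
  tensor :> H1 -> H2 -> K ;
  tensor_linear_l : forall y, linear (tensor ^~ y) ;
  tensor_linear_r : forall x, linear (tensor x) ;
  tensor_inner : forall x x' y y',
    inner (tensor x y) (tensor x' y') = inner x x' * inner y y' ;
  tensor_dense :
    closure (linear_span [set tensor z.1 z.2 | z in [set: H1 * H2]]) = setT }.

Definition tensor_op (H1 H2 K : hilbertType R) (tau : hilbert_tensor H1 H2 K)
    (X : H1 -> H1) (Y : H2 -> H2) : K -> K :=
  xget (fun _ => 0)
    [set T | bounded_operator T /\
             forall x y, T (tau x y) = tau (X x) (Y y)].

Definition diagonal_isometry (H K : hilbertType R) (tau : hilbert_tensor H H K)
    (J : Type) (e : J -> H) : H -> K :=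
  xget (fun _ => 0)
    [set U | [/\ linear U, forall x, `|U x| = `|x|
               & forall j, U (e j) = tau (e j) (e j)]].

Definition hadamard (H K : hilbertType R) (tau : hilbert_tensor H H K)
    (J : Type) (e : J -> H) (X Y : H -> H) : H -> H :=
  adjoint (diagonal_isometry tau e)
    \o tensor_op tau X Y \o diagonal_isometry tau e.

End Hadamard.

(* Main.v *)
(* Put C_j = A_j^(-1/2) B_j A_j^(-1/2). On a finite sum v of elementary tensors,
   the form <(G(r) (x) G(1 - r)) v, v> is the sum over j, k of
     q_jk(r) = |(C_j^(r/2) A_j^(1/2) (x) C_k^((1-r)/2) A_k^(1/2)) v|^2,
   and q_jk(x) + q_jk(y) - 2 q_jk((x + y)/2) is the squared norm of a difference
   of two such vectors, because powers of C_j and C_k add up. So each q_jk is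
   midpoint convex and bounded on [0, 1], hence convex. By density
   F(r) = <(G(r) o G(1 - r)) x, x> is convex, and it is symmetric about 1/2 since
   the Hadamard product is commutative. The first inequality is F(1/2) <= F(s);
   the second one compares F(s) with the chord between 1/2 and t.

   The powers come from the bound |p(X)| <= sup |p| over the spectrum of a
   self-adjoint X, for real polynomials p: the square of the norm N of p(X) is an
   approximate eigenvalue of p(X)^2, and factoring N^2 - p^2 over C locates a
   root of it in the spectrum. *)

Require Import Defs.
From HB Require Import structures.
From mathcomp Require Import all_boot all_order all_algebra sesquilinear.
From mathcomp Require Import all_classical all_reals all_analysis.
From mathcomp Require Import ring lra.

Set Implicit Arguments.
Unset Strict Implicit.
Unset Printing Implicit Defensive.

Import Order.TTheory GRing.Theory Num.Theory.
Import numFieldNormedType.Exports.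
Local Open Scope classical_set_scope.
Local Open Scope complex_scope.
Local Open Scope ring_scope.

(** * Norm and inner product with values in the totally ordered field [R] *)

Section RealNorm.
Context {R : realType}.
Implicit Types H K : hilbertType R.

(** Functional calculus, tensor operator, adjoint and diagonal isometry are all chosen by [xget]
    with default 0, so nothing can be said of them before an object with the defining property has
    been built; most of the proof does this.

    The main obstacle is the boundedness of [X (x) Y]. On finite sums of elementary tensors the
    obvious formula depends on the representation of the vector, and the termwise estimate does not
    bound it by the norm of the sum. For self-adjoint [X] with [|X| <= M], a root [S] of
    [4 M^2 - X^2] turns the bound into the positivity of a square. This is why real powers are
    constructed before any tensor operator.

    Invertibility is handled through lower bounds [c |x| <= |X x|]: together with orthogonal
    projection they describe the spectrum of a self-adjoint operator, and they survive composition.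

    In the exponent [r] no continuity of the powers is used: a bound that is uniform for [r] in
    [[0, 1]] upgrades midpoint convexity to convexity. The tensor square is the right place for it,
    since there the cores [C_j] and [C_k] of two different indices act on separate factors and
    commute. *)

Definition hnorm H (x : H) : R := complex.Re `|x|.
Definition rinner H (x y : H) : R := complex.Re (inner x y).

Lemma normE H (x : H) : `|x| = (hnorm x)%:C.
Proof. by rewrite /hnorm RRe_real // normr_real. Qed.

Lemma hnorm_ge0 H (x : H) : 0 <= hnorm x.
Proof. by rewrite -ler0c -normE. Qed.

Lemma hnorm0 H : hnorm (0 : H) = 0.
Proof. by rewrite /hnorm normr0. Qed.

Lemma hnorm_eq0 H (x : H) : hnorm x = 0 -> x = 0.
Proof. by move=> h; apply/eqP; rewrite -normr_eq0 normE h. Qed.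

Lemma hnorm_opp H (x : H) : hnorm (- x) = hnorm x.
Proof. by rewrite /hnorm normrN. Qed.

Lemma hdistC H (x y : H) : hnorm (x - y) = hnorm (y - x).
Proof. by rewrite -hnorm_opp opprB. Qed.

Lemma hnorm_triangle H (x y : H) : hnorm (x + y) <= hnorm x + hnorm y.
Proof. by rewrite -lecR rmorphD /= -!normE ler_normD. Qed.

Lemma hnormZ H (c : R[i]) (x : H) : hnorm (c *: x) = complex.Re `|c| * hnorm x.
Proof.
apply: complexI; rewrite rmorphM /= -normE normrZ normE.
by rewrite RRe_real // normr_real.
Qed.

Lemma hnormZr H (a : R) (x : H) : hnorm (a%:C *: x) = `|a| * hnorm x.
Proof. by rewrite hnormZ normc_def /= expr0n addr0 sqrtr_sqr. Qed.

Lemma inner_hnorm H (x : H) : inner x x = (hnorm x ^+ 2)%:C.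
Proof. by rewrite inner_norm normE rmorphXn. Qed.

Lemma innerC H (x y : H) : inner y x = (inner x y)^*%C.
Proof. by rewrite hermC /= expr0 mul1r. Qed.

(* The values of the forms are passed as equations, because rewriting with them
   afterwards would make unification unfold the operators. *)
Lemma inner_op_comb H (a b : R[i]) (P Q S : H -> H) x y (p q s : R[i]) :
  inner (P x) y = p -> inner (Q x) y = q -> inner (S x) y = s ->
  inner ((a *: P + b *: Q - S) x) y = a * p + b * q - s.
Proof.
move=> <- <- <-; rewrite -[(_ - _) x]/(a *: P x + b *: Q x - S x).
by rewrite linearBl linearDl !linearZl_LR.
Qed.

Lemma rinner_hnorm H (x : H) : rinner x x = hnorm x ^+ 2.
Proof. by rewrite /rinner inner_hnorm. Qed.

Lemma rinnerC H (x y : H) : rinner x y = rinner y x.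
Proof. by rewrite /rinner innerC; case: (inner _ _). Qed.

Lemma rinnerDl H (x y z : H) : rinner (x + y) z = rinner x z + rinner y z.
Proof. by rewrite /rinner linearDl raddfD. Qed.

Lemma rinnerDr H (x y z : H) : rinner z (x + y) = rinner z x + rinner z y.
Proof. by rewrite rinnerC rinnerDl !(rinnerC z). Qed.

Lemma rinnerNl H (x z : H) : rinner (- x) z = - rinner x z.
Proof. by rewrite /rinner linearNl raddfN. Qed.

Lemma rinnerNr H (x z : H) : rinner z (- x) = - rinner z x.
Proof. by rewrite rinnerC rinnerNl !(rinnerC z). Qed.

Lemma rinnerZl H (a : R) (x z : H) : rinner (a%:C *: x) z = a * rinner x z.
Proof.
rewrite /rinner linearZl_LR /=; case: (inner x z) => u v /=.
by rewrite mul0r subr0.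
Qed.

Lemma rinnerZr H (a : R) (x z : H) : rinner z (a%:C *: x) = a * rinner z x.
Proof. by rewrite rinnerC rinnerZl !(rinnerC z). Qed.

Lemma hnormD_sqr H (x y : H) :
  hnorm (x + y) ^+ 2 = hnorm x ^+ 2 + hnorm y ^+ 2 + 2 * rinner x y.
Proof.
rewrite -!rinner_hnorm rinnerDl !rinnerDr (rinnerC y x); ring.
Qed.

Lemma hnormB_sqr H (x y : H) :
  hnorm (x - y) ^+ 2 = hnorm x ^+ 2 + hnorm y ^+ 2 - 2 * rinner x y.
Proof. by rewrite hnormD_sqr hnorm_opp rinnerNr mulrN. Qed.

Lemma cauchy_schwarz H (x y : H) : `|rinner x y| <= hnorm x * hnorm y.
Proof.
have sqle : rinner x y ^+ 2 <= (hnorm x * hnorm y) ^+ 2.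
  have [/hnorm_eq0 ->|yn0] := eqVneq (hnorm y) 0.
    rewrite hnorm0 mulr0 expr0n /rinner linear0r expr0n.
    by [].
  (* This is the component of [x] orthogonal to [y], multiplied by [|y|^2] to avoid a quotient; its
     squared norm is [|y|^2 (|x|^2 |y|^2 - r^2)]. *)
  have : 0 <= hnorm ((hnorm y ^+ 2)%:C *: x - (rinner x y)%:C *: y) ^+ 2.
    by rewrite exprn_ge0 ?hnorm_ge0.
  rewrite hnormB_sqr !hnormZr !rinnerZl !rinnerZr !exprMn !real_normK ?num_real//.
  move: (hnorm_ge0 y) yn0; set a := hnorm y; set b := hnorm x.
  set r := rinner x y; move=> a0 an0 h.
  have a2 : 0 < a ^+ 2 by rewrite exprn_gt0 // lt_neqAle eq_sym an0.
  rewrite -subr_ge0 -(pmulr_rge0 _ a2); apply: le_trans h _.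
  by rewrite le_eqVlt; apply/orP; left; apply/eqP; ring.
rewrite -(@ler_pXn2r _ 2) ?nnegrE ?normr_ge0 ?mulr_ge0 ?hnorm_ge0 //.
by rewrite real_normK ?num_real.
Qed.

(** Reduces complex identities to real ones: an identity of real parts that also holds after
    multiplying one argument by [i] gives the imaginary parts. *)
Lemma Im_inner H (x y : H) : complex.Im (inner x y) = rinner x ('i%C *: y).
Proof.
rewrite /rinner linearZr_LR /=; case: (inner x y) => u v /=.
by rewrite mul0r sub0r mulN1r opprK.
Qed.

End RealNorm.

(** * Bounded and self-adjoint operators, completeness and density *)

Section BoundedOperators.
Context {R : realType}.
Implicit Types H K L : hilbertType R.

Definition opbound H K (T : H -> K) (M : R) : Prop :=
  forall x, hnorm (T x) <= M * hnorm x.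

Lemma linearfD H K (T : H -> K) : linear T -> {morph T : x y / x + y}.
Proof. by move=> Tl x y; rewrite -[x in LHS]scale1r Tl scale1r. Qed.

Lemma linearf0 H K (T : H -> K) : linear T -> T 0 = 0.
Proof.
by move=> Tl; apply: (addrI (T 0)); rewrite -linearfD // !addr0.
Qed.

Lemma linearfZ H K (T : H -> K) (c : R[i]) x :
  linear T -> T (c *: x) = c *: T x.
Proof. by move=> Tl; rewrite -[c *: x]addr0 Tl linearf0 // addr0. Qed.

Lemma linearfN H K (T : H -> K) : linear T -> {morph T : x / - x}.
Proof. by move=> Tl x; rewrite -scaleN1r linearfZ // scaleN1r. Qed.

Lemma linearfB H K (T : H -> K) : linear T -> {morph T : x y / x - y}.
Proof. by move=> Tl x y; rewrite linearfD // linearfN. Qed.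

Lemma linearf_sum H K (T : H -> K) (I : Type) (r : seq I) (F : I -> H) :
  linear T -> T (\sum_(i <- r) F i) = \sum_(i <- r) T (F i).
Proof.
move=> Tl; elim/big_rec2: _ => [|i u v _ <-]; first exact: linearf0.
by rewrite linearfD.
Qed.

Lemma cvg_hnormP H (u : nat -> H) (l : H) :
  (forall e : R, 0 < e -> exists N : nat,
     forall n, (N <= n)%N -> hnorm (l - u n) < e) <-> u n @[n --> \oo] --> l.
Proof.
split=> [h|/cvgrPdist_lt h e e0].
  apply/cvgrPdist_lt => e e0.
  have e0' : 0 < complex.Re e by move: e0; rewrite ltcE /= => /andP[].
  have [N hN] := h _ e0'; exists N => // n /hN.
  rewrite normE -(RRe_real (gtr0_real e0)) ltcR //.
have [|N _ hN] := h e%:C; first by rewrite ltcR.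
by exists N => n nN; move: (hN n nN); rewrite /= normE ltcR.
Qed.

Lemma hilbert_complete H (u : nat -> H) :
  (forall e : R, 0 < e -> exists N : nat,
     forall m n, (N <= m)%N -> (N <= n)%N -> hnorm (u m - u n) < e) ->
  exists l, forall e : R, 0 < e -> exists N : nat,
     forall n, (N <= n)%N -> hnorm (l - u n) < e.
Proof.
move=> hu.
suff /cauchy_cvg /cvg_ex [l hl] : cauchy (u n @[n --> \oo]).
  by exists l; apply/cvg_hnormP.
apply/cauchy_ballP => e e0.
have e0' : 0 < complex.Re e by move: e0; rewrite ltcE /= => /andP[].
have [N hN] := hu _ e0'.
exists ([set x | exists2 n, (N <= n)%N & x = u n],
  [set x | exists2 n, (N <= n)%N & x = u n]) => /=.
  by split; exists N => // n /= nN; exists n.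
move=> [x y] /= [[m mN ->] [n nN ->]].
rewrite -ball_normE /ball_ /= normE -(RRe_real (gtr0_real e0)) ltcR.
exact: hN.
Qed.

Lemma closure_hnorm H (D : set H) :
  closure D = setT -> forall (x : H) (e : R), 0 < e ->
  exists2 y, D y & hnorm (x - y) < e.
Proof.
move=> cD x e e0; have : closure D x by rewrite cD.
have e0' : 0 < e%:C by rewrite ltcR.
move=> /(_ (ball x e%:C) (nbhsx_ballx _ _ e0')) [y [Dy]].
by rewrite -ball_normE /ball_ /= normE ltcR; exists y.
Qed.

Lemma bounded_operatorP H K (T : H -> K) :
  bounded_operator T <-> linear T /\ exists2 M : R, 0 < M & opbound T M.
Proof.
split=> [[Tl Tc]|[Tl [M M0 TM]]].
  split=> //; move: (Tc 0) => /cvgrPdist_lt /(_ 1 ltr01) /nbhs_ballP [d /= d0 hd].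
  have d0' : 0 < complex.Re d by move: d0; rewrite ltcE /= => /andP[].
  exists (2 / complex.Re d) => [|x]; first by rewrite divr_gt0.
  have [/hnorm_eq0 ->|xn0] := eqVneq (hnorm x) 0.
    by rewrite linearf0 // !hnorm0 mulr0.
  have x0 : 0 < hnorm x by rewrite lt_neqAle eq_sym xn0 hnorm_ge0.
  set t := complex.Re d / 2 / hnorm x.
  have t0 : 0 < t by rewrite !divr_gt0.
  have := hd (t%:C *: x).
  rewrite -ball_normE /ball_ /= sub0r normrN normE hnormZr gtr0_norm //.
  rewrite linearf0 // sub0r normrN normE linearfZ // hnormZr gtr0_norm //.
  rewrite -(RRe_real (gtr0_real d0)) -[1]/(1%:C) !ltcR.
  rewrite /t divfK // gtr_pMr // invf_lt1 ?ltr1n //; move=> /(_ isT) h.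
  have -> : 2 / complex.Re d * hnorm x = t^-1.
    by rewrite /t; field; rewrite xn0 gt_eqF.
  by rewrite ltW // -(ltr_pM2l t0) mulfV // gt_eqF.
split=> // x; apply/cvgrPdist_lt => e e0.
have e0' : 0 < complex.Re e by move: e0; rewrite ltcE /= => /andP[].
apply/nbhs_ballP; exists (complex.Re e / M)%:C => /=.
  by rewrite ltcR divr_gt0.
move=> y; rewrite -ball_normE /ball_ /= normE ltcR => h.
rewrite normE -(RRe_real (gtr0_real e0)) ltcR -linearfB //.
by apply: le_lt_trans (TM _) _; rewrite mulrC -ltr_pdivlMr.
Qed.

Lemma bounded_operator_linear H K (T : H -> K) : bounded_operator T -> linear T.
Proof. by case. Qed.

Lemma dense_ge0 H (D : set H) (g : H -> R) :
  closure D = setT ->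
  (forall x (e : R), 0 < e -> exists2 d : R, 0 < d &
     forall y, hnorm (x - y) < d -> `|g x - g y| < e) ->
  (forall x, D x -> 0 <= g x) -> forall x, 0 <= g x.
Proof.
move=> cD gc gD x; rewrite leNgt; apply/negP => gx0.
have [d d0 hd] := gc x (- g x) ltac:(by rewrite oppr_gt0).
have [y Dy /hd] := closure_hnorm cD x d0.
by have := gD y Dy; rewrite ltr_norml => h /andP[]; lra.
Qed.

Lemma rinner_bounded_continuous H K (T S : H -> K) :
  bounded_operator T -> bounded_operator S ->
  forall x (e : R), 0 < e -> exists2 d : R, 0 < d &
     forall y, hnorm (x - y) < d ->
       `|rinner (T x) (S x) - rinner (T y) (S y)| < e.
Proof.
move=> /bounded_operatorP[Tl [M M0 TM]] /bounded_operatorP[Sl [N N0 SN]] x e e0.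
(* The difference of the forms is at most [M N |x - y| (|x| + |y|)], and [|x| + |y| <= 2 |x| + 1] as
   soon as [|x - y| < 1]. *)
set c := M * N * (2 * hnorm x + 1) + 1.
have x0 := hnorm_ge0 x.
have c0 : 0 < c by rewrite ltr_wpDl // !mulr_ge0 ?addr_ge0 ?mulr_ge0 // ltW.
exists (Num.min 1 (e / c)) => [|y]; first by rewrite lt_min ltr01 divr_gt0.
rewrite lt_min => /andP[h1 he].
have -> : rinner (T x) (S x) - rinner (T y) (S y) =
   rinner (T (x - y)) (S x) + rinner (T y) (S (x - y)).
  rewrite !linearfB // rinnerDl rinnerDr rinnerNl rinnerNr; ring.
have y1 : hnorm y <= hnorm x + hnorm (x - y).
  have -> : hnorm y = hnorm (x + (y - x)) by rewrite addrC subrK.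
  by rewrite -(hdistC y); apply: hnorm_triangle.
apply: le_lt_trans (ler_normD _ _) _.
have ha := cauchy_schwarz (T (x - y)) (S x).
have hb := cauchy_schwarz (T y) (S (x - y)).
have hc : hnorm (T (x - y)) * hnorm (S x) <= M * hnorm (x - y) * (N * hnorm x).
  by rewrite ler_pM ?hnorm_ge0.
have hd : hnorm (T y) * hnorm (S (x - y)) <= M * hnorm y * (N * hnorm (x - y)).
  by rewrite ler_pM ?hnorm_ge0.
move: he; rewrite ltr_pdivlMr // => he.
have he' : M * N * (2 * hnorm x + 1) * hnorm (x - y) <= hnorm (x - y) * c.
  by rewrite /c [leRHS]mulrC [leRHS]mulrDl mul1r lerDl hnorm_ge0.
apply: le_lt_trans he; apply: le_trans he'.
apply: le_trans (lerD (le_trans ha hc) (le_trans hb hd)) _.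
have -> : M * hnorm (x - y) * (N * hnorm x) + M * hnorm y * (N * hnorm (x - y))
  = (M * N * hnorm (x - y)) * (hnorm x + hnorm y) by ring.
have -> : M * N * (2 * hnorm x + 1) * hnorm (x - y) =
  (M * N * hnorm (x - y)) * (2 * hnorm x + 1) by ring.
by rewrite ler_wpM2l ?mulr_ge0 ?hnorm_ge0 ?(ltW M0) ?(ltW N0) //; lra.
Qed.

Lemma bounded_operatorB H K (T S : H -> K) :
  bounded_operator T -> bounded_operator S -> bounded_operator (T - S).
Proof.
move=> /bounded_operatorP[Tl [M M0 TM]] /bounded_operatorP[Sl [N N0 SN]].
apply/bounded_operatorP; split.
  by move=> a u v; rewrite !fctE Tl Sl scalerBr addrACA opprD.
exists (M + N) => [|x]; first exact: addr_gt0.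
rewrite -[(T - S) x]/(T x - S x) mulrDl; apply: le_trans (hnorm_triangle _ _) _.
by rewrite hnorm_opp lerD.
Qed.

Lemma bounded_operatorZ H K (c : R[i]) (T : H -> K) :
  bounded_operator T -> bounded_operator (c *: T).
Proof.
move=> /bounded_operatorP[Tl [M M0 TM]]; apply/bounded_operatorP; split.
  by move=> a u v; rewrite !fctE Tl scalerDr !scalerA mulrC.
have c0 : 0 <= complex.Re `|c| by rewrite -ler0c RRe_real ?normr_real.
exists ((complex.Re `|c| + 1) * M) => [|x].
  by rewrite mulr_gt0 // ltr_wpDl.
rewrite !fctE hnormZ -mulrA ler_pM ?hnorm_ge0 //.
by rewrite lerDl.
Qed.

Lemma bounded_operatorD H K (T S : H -> K) :
  bounded_operator T -> bounded_operator S -> bounded_operator (T + S).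
Proof.
move=> Tb Sb; rewrite -[S]opprK; apply: bounded_operatorB => //.
by have := bounded_operatorZ (-1) Sb; rewrite scaleN1r.
Qed.

Lemma bounded_operator_comp H K L (S : K -> L) (T : H -> K) :
  bounded_operator S -> bounded_operator T -> bounded_operator (S \o T).
Proof.
move=> /bounded_operatorP[Sl [N N0 SN]] /bounded_operatorP[Tl [M M0 TM]].
apply/bounded_operatorP; split; first by move=> a u v /=; rewrite Tl Sl.
exists (N * M) => [|x /=]; first exact: mulr_gt0.
by apply: le_trans (SN _) _; rewrite -mulrA ler_pM2l.
Qed.

Lemma bounded_operator_id H : bounded_operator (fun x : H => x).
Proof.
apply/bounded_operatorP; split=> //; exists 1 => // x; by rewrite mul1r.
Qed.

Lemma bounded_operator0 H K : bounded_operator (0 : H -> K).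
Proof.
apply/bounded_operatorP; split; first by move=> a u v /=; rewrite scaler0 addr0.
by exists 1 => // x; rewrite mul1r hnorm0 hnorm_ge0.
Qed.

Lemma bounded_operator_sum H K (I : Type) (r : seq I) (F : I -> H -> K) :
  (forall i, bounded_operator (F i)) -> bounded_operator (\sum_(i <- r) F i).
Proof.
move=> Fb; elim/big_rec: _ => [|i T _ Tb]; first exact: bounded_operator0.
exact: bounded_operatorD.
Qed.

Definition selfadjoint H (X : H -> H) : Prop :=
  forall x y, inner (X x) y = inner x (X y).

Lemma selfadjointD H (X Y : H -> H) :
  selfadjoint X -> selfadjoint Y -> selfadjoint (X + Y).
Proof.
by move=> hX hY x y; rewrite !fctE linearDl linearDr /= hX hY.
Qed.

Lemma selfadjoint0 H : selfadjoint (0 : H -> H).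
Proof. by move=> x y; rewrite linear0l linear0r. Qed.

Lemma selfadjoint_sum H (I : Type) (r : seq I) (F : I -> H -> H) :
  (forall i, selfadjoint (F i)) -> selfadjoint (\sum_(i <- r) F i).
Proof.
move=> Fb; elim/big_rec: _ => [|i T _ Tb]; first exact: selfadjoint0.
exact: selfadjointD.
Qed.

Lemma selfadjoint_rinner H (X : H -> H) x y :
  selfadjoint X -> rinner (X x) y = rinner x (X y).
Proof. by rewrite /rinner => ->. Qed.

Lemma inner_rinner H K (u v : H) (u' v' : K) :
  rinner u v = rinner u' v' ->
  rinner u ('i%C *: v) = rinner u' ('i%C *: v') -> inner u v = inner u' v'.
Proof.
rewrite -!Im_inner {1 2}/rinner.
by case: (inner u v) => a b; case: (inner u' v') => c d /= -> ->.
Qed.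

(* A complex quadratic form determines its sesquilinear form. *)
Lemma positive_op_selfadjoint H (X : H -> H) :
  linear X -> positive_op X -> selfadjoint X.
Proof.
move=> Xl Xp.
have XR x : complex.Im (inner (X x) x) = 0 by apply: ger0_Im; apply: Xp.
have h x y : rinner (X x) ('i%C *: y) + rinner (X y) ('i%C *: x) = 0.
  have := XR (x + y); rewrite linearfD // linearDl !linearDr /= !raddfD /= !XR.
  by rewrite !Im_inner add0r addr0.
have hi x y : rinner ('i%C *: x) ('i%C *: y) = rinner x y.
  rewrite /rinner linearZl_LR linearZr_LR /=.
  by case: (inner x y) => a b /=; ring.
have hr x y : rinner (X x) y = rinner x (X y).
  have := h x (- ('i%C *: y)).
  rewrite scalerN scalerA -expr2 sqr_i scaleN1r opprK linearfN // linearfZ //.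
  by rewrite rinnerNl hi (rinnerC (X y)); lra.
move=> x y; apply: inner_rinner; first exact: hr.
by rewrite hr linearfZ.
Qed.

End BoundedOperators.

(** * Spectrum of a self-adjoint operator and the spectral bound for polynomials *)

Section Spectrum.
Context {R : realType}.
Implicit Types H K : hilbertType R.

Lemma parallelogram H (u v : H) :
  hnorm (u - v) ^+ 2 + hnorm (u + v) ^+ 2 = 2 * hnorm u ^+ 2 + 2 * hnorm v ^+ 2.
Proof. by rewrite hnormB_sqr hnormD_sqr; ring. Qed.

Lemma natSinv_lt (e : R) : 0 < e ->
  exists N : nat, forall n, (N <= n)%N -> n.+1%:R^-1 < e.
Proof.
move=> e0; exists (Num.bound e^-1) => n Nn.
rewrite invf_plt ?posrE ?ltr0Sn //.
apply: lt_le_trans (archi_boundP _) _; first by rewrite invr_ge0 ltW.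
by rewrite ler_nat ltnW.
Qed.

(** Orthogonal projection of [y] onto the range of [T]. The lower bound on [T] transfers the Cauchy
    property from the images [T (u n)] of a minimising sequence back to [u n]. It serves both to
    invert [mu - X] and to construct the adjoint of the diagonal isometry. *)
Lemma least_squares H K (T : H -> K) (c : R) :
  bounded_operator T -> 0 < c -> (forall x, c * hnorm x <= hnorm (T x)) ->
  forall y, exists x, forall z, inner (T z) (y - T x) = 0.
Proof.
move=> /bounded_operatorP[Tl [M M0 TM]] c0 Tc y.
set S := [set r : R | exists x, r = hnorm (y - T x) ^+ 2].
have S0 : S !=set0 by exists (hnorm (y - T 0) ^+ 2); exists 0.
have Slb : has_lbound S by exists 0 => _ [x ->]; rewrite exprn_ge0 ?hnorm_ge0.
pose d := inf S.
have dle x : d <= hnorm (y - T x) ^+ 2 by apply: ge_inf => //; exists x.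
have /choice[u hu] : forall n : nat, exists x, hnorm (y - T x) ^+ 2 < d + n.+1%:R^-1.
  move=> n; have n0 : 0 < n.+1%:R^-1 :> R by rewrite invr_gt0 ltr0Sn.
  by have [_ [x ->] hx] := inf_adherent n0 (conj S0 Slb); exists x.
have [e e0|x hx] := hilbert_complete (u := u).
  (* The parallelogram law gives [|T (u m - u n)|^2 <= 2 / (m + 1) + 2 / (n + 1)], because the
     midpoint of [u m] and [u n] has residual at least [d]. *)
  have [|N hN] := @natSinv_lt ((c * e) ^+ 2 / 4).
    by rewrite divr_gt0 // exprn_gt0 // mulr_gt0.
  exists N => m n mN nN.
  rewrite -(ltr_pM2l c0); apply: le_lt_trans (Tc _) _.
  rewrite -(@ltr_pXn2r _ 2) ?nnegrE ?hnorm_ge0 ?mulr_ge0 ?(ltW c0) ?(ltW e0) //.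
  have := parallelogram (y - T (u n)) (y - T (u m)).
  have -> : y - T (u n) - (y - T (u m)) = T (u m - u n).
    by rewrite linearfB // opprB addrAC addrCA subrr addr0 addrC.
  have -> : y - T (u n) + (y - T (u m)) =
      2%:C *: (y - T ((2^-1)%:C *: (u n + u m))).
    rewrite linearfZ // scalerBr scalerA -rmorphM mulfV ?pnatr_eq0 //.
    rewrite rmorph1 scale1r linearfD // opprD addrACA; congr (_ + _).
    by rewrite rmorph_nat scaler_nat mulr2n.
  rewrite hnormZr exprMn real_normK ?num_real //.
  have := dle ((2^-1)%:C *: (u n + u m)).
  have := hu n; have := hu m; have := hN m mN; have := hN n nN.
  move: (hnorm _ ^+ 2) (hnorm _ ^+ 2) (hnorm _ ^+ 2) (hnorm _ ^+ 2).
  move: (n.+1%:R^-1) (m.+1%:R^-1) ((c * e) ^+ 2) => i j g a b p q; lra.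
exists x.
have xd : hnorm (y - T x) ^+ 2 <= d.
  rewrite leNgt; apply/negP => dlt.
  set a := hnorm (y - T x) in dlt.
  have a0 : 0 <= a by apply: hnorm_ge0.
  (* Half of the excess goes to the error of [u n] as a near minimiser, half to its distance from
     [x]: if [b < a], then [a^2 - b^2 <= (a - b) (2 a + 1) < eta]. *)
  set eta := (a ^+ 2 - d) / 2.
  have eta0 : 0 < eta by rewrite divr_gt0 // subr_gt0.
  have [N1 h1] := natSinv_lt eta0.
  have [|N2 h2] := hx (Num.min 1 (eta / (2 * a + 1)) / M).
    by rewrite divr_gt0 // lt_min ltr01 divr_gt0 // ltr_wpDl // mulr_ge0.
  pose n := maxn N1 N2.
  have := h1 n (leq_maxl _ _); have := h2 n (leq_maxr _ _).
  rewrite ltr_pdivlMr // lt_min ltr_pdivlMr ?ltr_wpDl ?mulr_ge0 //.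
  have Tx := TM (x - u n).
  have := hu n; set b := hnorm (y - T (u n)).
  have b0 : 0 <= b by apply: hnorm_ge0.
  have ab : a <= b + M * hnorm (x - u n).
    rewrite /a -[y - T x](subrK (y - T (u n))) addrC.
    apply: le_trans (hnorm_triangle _ _) _; rewrite lerD2l.
    rewrite opprB addrC -addrA addKr hdistC -linearfB //.
  move: ab; rewrite (mulrC M).
  move: (hnorm (x - u n) * M) => g abg hb /andP[g1 g2] hn.
  move: n.+1%:R^-1 hb hn => i hb hn.
  have [ba|ba] := leP a b.
    have : a ^+ 2 <= b ^+ 2 by rewrite ler_pXn2r ?nnegrE.
    by rewrite /eta in hn; lra.
  have : (a - b) * (a + b) <= g * (2 * a + 1).
    by apply: ler_pM; lra.
  by rewrite /eta in hn g2; rewrite mulrDr !mulrBl -!expr2 (mulrC b a); lra.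
have hr z : rinner (T z) (y - T x) = 0.
  set r := rinner _ _; set q := hnorm (T z) ^+ 2.
  have q0 : 0 <= q by rewrite exprn_ge0 ?hnorm_ge0.
  (* First variation at the minimiser: with [s = r / (q + 1)] the change of the squared residual is
     [s^2 q - 2 s r = - s^2 (q + 2)], which forces [s = 0]. The [+ 1] covers [T z = 0]. *)
  have := le_trans xd (dle (x + (r / (q + 1))%:C *: z)).
  rewrite linearfD // opprD addrA linearfZ // [leRHS]hnormB_sqr hnormZr exprMn.
  rewrite real_normK ?num_real // rinnerZr rinnerC -/r -/q.
  rewrite -addrA lerDl; set s := r / (q + 1) => h.
  have hs : s * (q + 1) = r by rewrite divfK // gt_eqF // ltr_wpDl.
  have : s ^+ 2 * (q + 2) <= 0 by rewrite -hs in h; lra.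
  rewrite pmulr_lle0 ?ltr_wpDl // => s2.
  have /eqP : s ^+ 2 == 0 by rewrite eq_le s2 sqr_ge0.
  by move=> /eqP; rewrite sqrf_eq0 -hs => /eqP ->; rewrite mul0r.
move=> z; rewrite -[RHS](linear0l inner (0 : K)).
apply: inner_rinner; first by rewrite hr rinner_hnorm hnorm0 expr0n.
rewrite -Im_inner; have := hr ('i%C *: z).
rewrite {2}/rinner linear0l /= linearfZ // /rinner linearZl_LR /=.
by case: (inner _ _) => a b /=; lra.
Qed.

Lemma selfadjoint_inner_real H (X : H -> H) x :
  selfadjoint X -> complex.Im (inner (X x) x) = 0.
Proof.
move=> Xs; have := congr1 (@complex.Im R) (innerC (X x) x).
by rewrite -Xs; case: (inner _ _) => a b /=; lra.
Qed.

(** [mu - X] is normal: its adjoint is [mu^* - X] and commutes with it. *)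
Lemma hnorm_shift_conj H (X : H -> H) (mu : R[i]) x :
  selfadjoint X -> hnorm (mu *: x - X x) = hnorm (mu^*%C *: x - X x).
Proof.
move=> Xs; apply/eqP; rewrite -(@eqrXn2 _ 2) ?hnorm_ge0 //; apply/eqP.
rewrite !hnormB_sqr !hnormZ normcJ /rinner !linearZl_LR /=.
have := selfadjoint_inner_real x Xs; rewrite Xs.
by case: mu => a b; case: (inner _ _) => c d /= ->; ring.
Qed.

Lemma bounded_shift H (X : H -> H) (mu : R[i]) :
  bounded_operator X -> bounded_operator (fun x => mu *: x - X x).
Proof.
move=> Xb; have := bounded_operatorB (bounded_operatorZ mu (bounded_operator_id H)) Xb.
by apply.
Qed.

(** A lower bound already gives surjectivity: a residual [w] orthogonal to the range of [T = mu - X]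
    is killed by the adjoint [mu^* - X], hence by [T] itself by normality, and [T] is injective. *)
Lemma spectrumP H (X : H -> H) (mu : R[i]) :
  bounded_operator X -> selfadjoint X ->
  ~ spectrum X mu <-> exists2 c : R, 0 < c &
    forall x, c * hnorm x <= hnorm (mu *: x - X x).
Proof.
move=> Xb Xs; have Tb := bounded_shift mu Xb.
set T := fun x => mu *: x - X x in Tb *.
have Tl : linear T by case: Tb.
split=> [/contrapT [Y [/bounded_operatorP[Yl [M M0 YM]] TY YT]]|[c c0 Tc]].
  exists M^-1 => [|x]; first by rewrite invr_gt0.
  rewrite ler_pdivrMl //; apply: le_trans (YM _).
  by rewrite -[Y _]/((Y \o T) x) YT.
have Tinj x y : T x = T y -> x = y.
  move=> Txy; apply/eqP; rewrite -subr_eq0; apply/eqP/hnorm_eq0/eqP.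
  rewrite eq_le hnorm_ge0 andbT -(pmulr_rle0 _ c0).
  by apply: le_trans (Tc _) _; rewrite -/(T _) linearfB // Txy subrr hnorm0.
have /choice[Y TY] : forall y, exists x, T x = y.
  move=> y; have [x hx] := least_squares Tb c0 Tc y.
  exists x; apply/eqP; rewrite eq_sym -subr_eq0; apply/eqP.
  set w := y - T x in hx *.
  apply: Tinj; rewrite (linearf0 Tl); apply: hnorm_eq0.
  rewrite /T hnorm_shift_conj // -/T.
  suff -> : mu^*%C *: w - X w = 0 by rewrite hnorm0.
  apply: hnorm_eq0; apply/eqP; rewrite -sqrf_eq0 -rinner_hnorm; apply/eqP.
  set v := mu^*%C *: w - X w.
  rewrite /rinner {2}/v linearBr linearZr_LR /= -Xs conjCK -linearZl_LR.
  by have := hx v; rewrite /T linearBl => ->.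
suff : invertible_op T by move=> ? ?.
exists Y; split; [apply/bounded_operatorP; split|exact: funext|].
- by move=> a u v; apply: Tinj; rewrite Tl !TY.
- exists c^-1 => [|x]; first by rewrite invr_gt0.
  by rewrite ler_pdivlMl // -{2}(TY x).
- by apply: funext => x /=; apply: Tinj; rewrite TY.
Qed.

(** For [mu = a + i b] the cross term vanishes, as [<(a - X) x, x>] is real, so that [|(mu - X) x|^2
    = |(a - X) x|^2 + b^2 |x|^2]. Thus [|b|] is a lower bound. *)
Lemma spectrum_real H (X : H -> H) (mu : R[i]) :
  bounded_operator X -> selfadjoint X -> spectrum X mu ->
  mu = (complex.Re mu)%:C.
Proof.
move=> Xb Xs; apply: contraPeq => mun; apply/spectrumP => //.
case: mu mun => a b ab; exists `|b|.
  rewrite normr_gt0; apply: contra_neq ab => /= ->; by rewrite complexr0.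
move=> x; rewrite -(@ler_pXn2r _ 2) ?nnegrE ?mulr_ge0 ?hnorm_ge0 ?normr_ge0 //.
have -> : (a +i* b)%C *: x - X x = (a%:C *: x - X x) + b%:C *: ('i%C *: x).
  rewrite scalerA addrAC -scalerDl; congr (_ *: _ - _).
  by apply/eqP; rewrite eq_complex /=; apply/andP; split; apply/eqP; ring.
rewrite hnormD_sqr rinnerZr -Im_inner linearBl linearZl_LR /= raddfB /=.
rewrite selfadjoint_inner_real // subr0 inner_hnorm /= mul0r mulr0 addr0 !mulr0.
rewrite addr0 hnormZr !exprMn hnormZ normc_def /= expr0n expr1n add0r sqrtr1 mul1r.
by rewrite lerDr exprn_ge0 ?hnorm_ge0.
Qed.

(** Complex coefficients, because a real polynomial splits into linear factors only over [R[i]]. *)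
Definition cpoly_op H (p : {poly R[i]}) (X : H -> H) : H -> H :=
  fun x => \sum_(i < size p) p`_i *: iter i X x.

Lemma cpoly_op_wide H (p : {poly R[i]}) (X : H -> H) n x : (size p <= n)%N ->
  cpoly_op p X x = \sum_(i < n) p`_i *: iter i X x.
Proof.
move=> pn; rewrite /cpoly_op (big_ord_widen n (fun i => p`_i *: iter i X x)) //.
rewrite [LHS]big_mkcond; apply: eq_bigr => i _; case: ltnP => // ip.
by rewrite nth_default // scale0r.
Qed.

Lemma poly_opE H (p : {poly R}) (X : H -> H) :
  poly_op p X = cpoly_op (map_poly (real_complex R) p) X.
Proof.
apply: funext => x; rewrite /poly_op /cpoly_op size_map_poly.
by apply: eq_bigr => i _; rewrite coef_map.
Qed.

Lemma cpoly_opD H (p q : {poly R[i]}) (X : H -> H) x :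
  cpoly_op (p + q) X x = cpoly_op p X x + cpoly_op q X x.
Proof.
set n := maxn (size p) (size q).
rewrite (@cpoly_op_wide _ (p + q) _ n) ?size_polyD //.
rewrite (@cpoly_op_wide _ p _ n) ?leq_maxl //.
rewrite (@cpoly_op_wide _ q _ n) ?leq_maxr // -big_split.
by apply: eq_bigr => i _; rewrite coefD scalerDl.
Qed.

Lemma cpoly_opC H (c : R[i]) (X : H -> H) x : cpoly_op c%:P X x = c *: x.
Proof.
by rewrite (@cpoly_op_wide _ _ _ 1) ?size_polyC_leq1 // big_ord1 coefC.
Qed.

Lemma cpoly_opMX H (p : {poly R[i]}) (X : H -> H) x :
  linear X -> cpoly_op (p * 'X) X x = X (cpoly_op p X x).
Proof.
move=> Xl; rewrite (@cpoly_op_wide _ _ _ (size p).+1); last first.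
  by apply: leq_trans (size_polyMleq _ _) _; rewrite size_polyX addn2.
rewrite big_ord_recl coefMX /= scale0r add0r linearf_sum //.
by apply: eq_bigr => i _; rewrite coefMX /= linearfZ.
Qed.

Lemma cpoly_opM H (p q : {poly R[i]}) (X : H -> H) x :
  linear X -> cpoly_op (p * q) X x = cpoly_op p X (cpoly_op q X x).
Proof.
move=> Xl; elim/poly_ind: p => [|p c IH].
  by rewrite mul0r !cpoly_opC !scale0r.
rewrite mulrDl cpoly_opD mulrAC cpoly_opMX // IH cpoly_opD cpoly_opMX //.
congr (_ + _); rewrite cpoly_opC mul_polyC.
rewrite (@cpoly_op_wide _ _ _ (size q)) ?size_scale_leq // scaler_sumr.
by apply: eq_bigr => i _; rewrite coefZ scalerA.
Qed.

Lemma poly_opD H (p q : {poly R}) (X : H -> H) x :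
  poly_op (p + q) X x = poly_op p X x + poly_op q X x.
Proof. by rewrite !poly_opE rmorphD cpoly_opD. Qed.

Lemma poly_opM H (p q : {poly R}) (X : H -> H) x :
  linear X -> poly_op (p * q) X x = poly_op p X (poly_op q X x).
Proof. by move=> Xl; rewrite !poly_opE rmorphM cpoly_opM. Qed.

Lemma poly_opC H (c : R) (X : H -> H) x : poly_op c%:P X x = c%:C *: x.
Proof. by rewrite poly_opE map_polyC cpoly_opC. Qed.

Lemma poly_opX H (X : H -> H) x : linear X -> poly_op 'X X x = X x.
Proof.
move=> Xl; rewrite poly_opE map_polyX -['X]mul1r cpoly_opMX //.
by rewrite -polyC1 cpoly_opC scale1r.
Qed.

Lemma poly_opB H (p q : {poly R}) (X : H -> H) x :
  linear X -> poly_op (p - q) X x = poly_op p X x - poly_op q X x.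
Proof.
move=> Xl; rewrite poly_opD -[- q]mulN1r poly_opM // -polyC1 -polyCN poly_opC.
by rewrite rmorphN rmorph1 scaleN1r.
Qed.

Lemma bounded_operator_ext H K (T S : H -> K) : T =1 S ->
  bounded_operator T -> bounded_operator S.
Proof. by move=> /funext ->. Qed.

Lemma poly_op_bounded H (p : {poly R}) (X : H -> H) :
  bounded_operator X -> bounded_operator (poly_op p X).
Proof.
move=> Xb; have Xl := bounded_operator_linear Xb.
elim/poly_ind: p => [|p c IH].
  apply: (@bounded_operator_ext _ _ 0 _ _ (bounded_operator0 H H)) => x.
  by rewrite -polyC0 poly_opC scale0r.
apply: (@bounded_operator_ext _ _ (X \o poly_op p X + c%:C *: (fun x => x))).
  move=> x; rewrite poly_opD poly_opC mulrC poly_opM // poly_opX //.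
by apply: bounded_operatorD; [apply: bounded_operator_comp|
  apply: bounded_operatorZ; apply: bounded_operator_id].
Qed.

Lemma poly_op_selfadjoint H (p : {poly R}) (X : H -> H) :
  linear X -> selfadjoint X -> selfadjoint (poly_op p X).
Proof.
move=> Xl Xs; elim/poly_ind: p => [|p c IH] x y.
  by rewrite -polyC0 !poly_opC !scale0r linear0l linear0r.
rewrite !poly_opD linearDl linearDr /=; congr (_ + _).
  by rewrite {1}mulrC !poly_opM // !poly_opX // Xs IH.
rewrite !poly_opC linearZl_LR linearZr_LR /=; congr (_ * _).
exact/esym/conjc_real.
Qed.

(* Over C the polynomial splits into linear factors z - mu, each of which is
   bounded below at X because mu is not in the spectrum. *)
Lemma cpoly_op_bounded_below H (q : {poly R[i]}) (X : H -> H) :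
  bounded_operator X -> selfadjoint X -> q != 0 ->
  (forall mu, spectrum X mu -> ~~ root q mu) ->
  exists2 c : R, 0 < c & forall x, c * hnorm x <= hnorm (cpoly_op q X x).
Proof.
move=> Xb Xs; have Xl := bounded_operator_linear Xb.
have [n] := ubnP (size q); elim: n q => // n IH q qn q0 hq.
have [/size_poly1P[a a0 ->]|] := boolP (size q == 1%N).
  exists (complex.Re `|a|) => [|x].
    by rewrite -ltcR RRe_real ?normr_real // normr_gt0.
  by rewrite cpoly_opC hnormZ.
move=> /closed_rootP[mu rmu]; have /factor_theorem[p qE] := rmu.
have p0 : p != 0 by apply: contra_neq q0 => p0; rewrite qE p0 mul0r.
have /spectrumP[//|//|c c0 hc] : ~ spectrum X mu by move=> /hq; rewrite rmu.
have [||nu /hq|d d0 hd] := IH p => //.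
- move: qn; rewrite qE size_mul ?polyXsubC_eq0 // size_XsubC addn2 /=.
  by rewrite ltnS.
- by apply: contra => r; rewrite qE rootM r.
exists (d * c) => [|x]; first exact: mulr_gt0.
rewrite qE cpoly_opM // -mulrA; apply: le_trans (hd _).
rewrite ler_pM2l // cpoly_opD -['X]mul1r cpoly_opMX // -polyC1 cpoly_opC scale1r.
by rewrite -polyCN cpoly_opC scaleNr hdistC hc.
Qed.

(* N is the operator norm, almost attained at some x, and
   |(N^2 - T^2) x|^2 <= N^2 (N^2 |x|^2 - |T x|^2). *)
Lemma norm_sqr_not_bounded_below H (T : H -> H) :
  bounded_operator T -> selfadjoint T -> (exists x : H, x != 0) ->
  exists2 N : R, 0 <= N /\ opbound T N & forall c : R, 0 < c -> exists x,
    hnorm ((N ^+ 2)%:C *: x - T (T x)) < c * hnorm x.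
Proof.
move=> /bounded_operatorP[Tl [M M0 TM]] Ts [z z0].
pose S := [set hnorm (T x) | x in [set x : H | hnorm x = 1]].
have nz x : x != 0 :> H -> hnorm ((hnorm x)^-1%:C *: x) = 1.
  move=> xn0; rewrite hnormZr ger0_norm ?invr_ge0 ?hnorm_ge0 // mulVf //.
  by apply: contra_neq xn0 => /hnorm_eq0.
have S0 : S !=set0.
  by exists (hnorm (T ((hnorm z)^-1%:C *: z))), ((hnorm z)^-1%:C *: z) => //=; apply: nz.
have Sub : has_ubound S.
  by exists M => _ [x /= x1 <-]; rewrite -[M]mulr1 -x1.
pose N := sup S.
have N0 : 0 <= N.
  have [r [x /= x1 _]] := S0.
  by apply: le_trans (hnorm_ge0 (T x)) _; apply: ub_le_sup => //; exists x.
have NT : opbound T N.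
  move=> x; have [->|xn0] := eqVneq x 0; first by rewrite linearf0 // !hnorm0 mulr0.
  have : hnorm (T ((hnorm x)^-1%:C *: x)) <= N.
    by apply: ub_le_sup => //; exists ((hnorm x)^-1%:C *: x) => //=; apply: nz.
  rewrite linearfZ // hnormZr ger0_norm ?invr_ge0 ?hnorm_ge0 // ler_pdivrMl 1?mulrC //.
  by rewrite lt_neqAle hnorm_ge0 andbT eq_sym; apply: contra_neq xn0 => /hnorm_eq0.
exists N => // c c0.
set d := Num.min 1 (c ^+ 2 / (2 * N * N ^+ 2 + 1)).
have N3 : 0 < 2 * N * N ^+ 2 + 1 by rewrite ltr_wpDl // !mulr_ge0 // exprn_ge0.
have d0 : 0 < d by rewrite lt_min ltr01 divr_gt0 // exprn_gt0.
have [_ [x /= x1 <-] hx] := sup_adherent d0 (conj S0 Sub).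
exists x; rewrite x1 mulr1 -(@ltr_pXn2r _ 2) ?nnegrE ?hnorm_ge0 ?(ltW c0) //.
rewrite hnormB_sqr hnormZr rinnerZl ger0_norm ?exprn_ge0 // x1 mulr1.
rewrite -selfadjoint_rinner // rinner_hnorm.
have TT := NT (T x); have Tx := NT x; rewrite x1 mulr1 in Tx.
set a := hnorm (T x) in hx TT Tx *.
have a0 : 0 <= a by apply: hnorm_ge0.
have TT2 : hnorm (T (T x)) ^+ 2 <= N ^+ 2 * a ^+ 2.
  by rewrite -exprMn ler_pXn2r ?nnegrE ?mulr_ge0 ?hnorm_ge0.
have h1 : N ^+ 2 - a ^+ 2 <= 2 * N * d.
  have -> : N ^+ 2 - a ^+ 2 = (N + a) * (N - a) by ring.
  apply: ler_pM; [exact: addr_ge0|by rewrite subr_ge0| |].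
    by rewrite mulr_natl mulr2n lerD2l.
  by rewrite lerBlDr addrC -lerBlDr ltW.
have h2 : d * (2 * N * N ^+ 2 + 1) <= c ^+ 2.
  by rewrite -ler_pdivlMr // ge_min lexx orbT.
apply: (@le_lt_trans _ _ (N ^+ 2 * (2 * N * d))); last first.
  by apply: lt_le_trans h2; rewrite -subr_gt0;
   rewrite (_ : _ - _ = d) //; ring.
apply: le_trans (ler_wpM2l (exprn_ge0 2 N0) h1).
rewrite -/N; move: TT2; set b := hnorm (T (T x)) ^+ 2.
move: b => b hb; rewrite -subr_ge0.
have -> : N ^+ 2 * (N ^+ 2 - a ^+ 2) -
    ((N ^+ 2) ^+ 2 + b - 2 * (N ^+ 2 * a ^+ 2)) = N ^+ 2 * a ^+ 2 - b by ring.
by rewrite subr_ge0.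
Qed.

(** If [p ^+ 2] is the constant [N ^+ 2], the polynomial [N^2 - p^2] is zero and cannot be factored.
    In that case every point of the spectrum satisfies the conclusion, provided that there is one,
    which is settled next. *)
Lemma poly_norm_root H (p : {poly R}) (X : H -> H) :
  bounded_operator X -> selfadjoint X -> (exists x : H, x != 0) ->
  exists2 N : R, 0 <= N /\ opbound (poly_op p X) N &
    p ^+ 2 != (N ^+ 2)%:P ->
    exists2 l : R, spectrum X l%:C & p.[l] ^+ 2 = N ^+ 2.
Proof.
move=> Xb Xs H0; have Xl := bounded_operator_linear Xb.
have [N NT hN] := norm_sqr_not_bounded_below (poly_op_bounded p Xb)
   (poly_op_selfadjoint p Xl Xs) H0.
exists N => // pN; apply: contrapT => hl.
set q : {poly R} := (N ^+ 2)%:P - p ^+ 2.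
have q0 : q != 0 by rewrite subr_eq0 eq_sym.
have qC0 : map_poly (real_complex R) q != 0 by rewrite map_poly_eq0.
have [mu smu|c c0 hc] := cpoly_op_bounded_below Xb Xs qC0.
  rewrite (spectrum_real Xb Xs smu) fmorph_root; apply/negP => /rootP.
  rewrite !hornerE => /eqP; rewrite subr_eq0 => /eqP h.
  by apply: hl; exists (complex.Re mu); rewrite -?(spectrum_real Xb Xs smu) // -h.
have [x] := hN c c0; apply/negP; rewrite -leNgt.
apply: le_trans (hc x) _; rewrite -poly_opE poly_opB // poly_opC.
by rewrite expr2 poly_opM.
Qed.

(** Take [p = 'X]: its square is not constant, so the exceptional case above is excluded. *)
Lemma spectrum_nonempty H (X : H -> H) :
  bounded_operator X -> selfadjoint X -> (exists x : H, x != 0) ->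
  exists l : R, spectrum X l%:C.
Proof.
move=> Xb Xs H0; have [N _ hN] := poly_norm_root 'X Xb Xs H0.
have [|l sl _] := hN; last by exists l.
by apply/eqP => /(congr1 (fun p : {poly R} => size p)); rewrite size_polyXn => h;
  have := size_polyC_leq1 (N ^+ 2); rewrite -h.
Qed.

Theorem poly_op_spectral_bound H (p : {poly R}) (X : H -> H) (M : R) :
  bounded_operator X -> selfadjoint X -> 0 <= M ->
  (forall l, spectrum X l%:C -> `|p.[l]| <= M) -> opbound (poly_op p X) M.
Proof.
move=> Xb Xs M0 hM x.
have [->|x0] := eqVneq x 0.
  rewrite linearf0 ?hnorm0 ?mulr0 //.
  exact: (bounded_operator_linear (poly_op_bounded p Xb)).
have H0 : exists x : H, x != 0 by exists x.
have [N [N0 NT] hN] := poly_norm_root p Xb Xs H0.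
apply: le_trans (NT x) _; rewrite ler_wpM2r ?hnorm_ge0 //.
have [l sl hl] : exists2 l : R, spectrum X l%:C & p.[l] ^+ 2 = N ^+ 2.
  have [pN|] := eqVneq (p ^+ 2) (N ^+ 2)%:P; last exact: hN.
  have [l sl] := spectrum_nonempty Xb Xs H0; exists l => //.
  by rewrite -horner_exp pN hornerC.
have := hM l sl; rewrite -(@ler_pXn2r _ 2 isT `|_|) ?nnegrE ?normr_ge0 //.
by rewrite real_normK ?num_real // hl ler_pXn2r ?nnegrE.
Qed.

End Spectrum.

(** * Continuous functional calculus as a limit of polynomials *)

Section FunctionalCalculus.
Context {R : realType}.
Implicit Types H K : hilbertType R.

(* A single polynomial within [e] of both [f] and [Y]; no sequence is needed. *)
Lemma is_functional_calculusP H (X : H -> H) (f : R -> R) (Y : H -> H) :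
  is_functional_calculus X f Y <-> forall e : R, 0 < e -> exists p : {poly R},
    (forall l, spectrum X l%:C -> `|f l - p.[l]| <= e) /\
    opbound (poly_op p X - Y) e.
Proof.
split=> [[p [pf pY]] e e0|h].
  have entE : entourage [set xy : R * R | `|xy.1 - xy.2| < e].
    by rewrite -entourage_ballE; exists e.
  have /pf[N1 _ h1] := (@uniform_nbhs R [set l : R | spectrum X l%:C] R f
      [set h | forall l, spectrum X l%:C -> `|f l - h l| < e]).2
    (ex_intro _ _ (conj entE (fun h hh => hh))).
  have [N2 _ h2] := pY e e0.
  exists (p (maxn N1 N2)); split=> [l sl|x].
    by apply: ltW; apply: (h1 (maxn N1 N2)) => //=; rewrite leq_maxl.
  rewrite -lecR -normE rmorphM /= -normE.
  by apply: (h2 (maxn N1 N2)) => //=; rewrite leq_maxr.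
have /choice[p hp] : forall n : nat, exists p : {poly R},
    (forall l, spectrum X l%:C -> `|f l - p.[l]| <= n.+1%:R^-1) /\
    opbound (poly_op p X - Y) n.+1%:R^-1.
  by move=> n; apply: h; rewrite invr_gt0.
exists p; split=> [S /uniform_nbhs[E [entE ES]]|e e0].
  move: entE; rewrite -entourage_ballE => -[e /= e0 he].
  have [N hN] := natSinv_lt e0; exists N => // n /hN hn; apply: ES => /= l sl.
  by apply: he; rewrite /= /ball /=; apply: le_lt_trans hn; apply: (hp n).1.
have [N hN] := natSinv_lt e0; exists N => // n /hN hn x.
rewrite !normE -rmorphM lecR; apply: le_trans ((hp n).2 x) _.
by rewrite ler_wpM2r ?hnorm_ge0 // ltW.
Qed.

Section Calculus.
Variables (H : hilbertType R) (X : H -> H).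
Hypotheses (Xb : bounded_operator X) (Xs : selfadjoint X).

Lemma functional_calculus_opbound f Y (F : R) : is_functional_calculus X f Y ->
  0 <= F -> (forall l, spectrum X l%:C -> `|f l| <= F) -> opbound Y F.
Proof.
move=> /is_functional_calculusP h F0 hF x.
apply/ler_addgt0Pr => /= e e0.
have [|p [pf pY]] := h (e / (2 * (hnorm x + 1))).
  by rewrite divr_gt0 // mulr_gt0 // ltr_wpDl ?hnorm_ge0.
set d := e / _ in pf pY.
have d0 : 0 <= d by rewrite divr_ge0 ?mulr_ge0 ?addr_ge0 ?hnorm_ge0 // ltW.
have pX : opbound (poly_op p X) (F + d).
  apply: poly_op_spectral_bound => //; first exact: addr_ge0.
  move=> l sl; rewrite -[p.[l]](subrK (f l)) addrC.
  apply: le_trans (ler_normD _ _) _; apply: lerD; first exact: hF.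
  by rewrite distrC; apply: pf.
have -> : Y x = poly_op p X x - (poly_op p X - Y) x.
  by rewrite -[(poly_op p X - Y) x]/(poly_op p X x - Y x) opprB addrC subrK.
apply: le_trans (hnorm_triangle _ _) _; rewrite hnorm_opp.
apply: le_trans (lerD (pX x) (pY x)) _.
rewrite mulrDl -addrA lerD2l -mulrDl.
have -> : e = (d + d) * (hnorm x + 1).
  by rewrite /d; field; rewrite gt_eqF // ltr_wpDl ?hnorm_ge0.
by rewrite ler_wpM2l ?addr_ge0 // lerDl.
Qed.

Lemma functional_calculus_unique f g Y Z :
  is_functional_calculus X f Y -> is_functional_calculus X g Z ->
  (forall l, spectrum X l%:C -> f l = g l) -> Y = Z.
Proof.
move=> /is_functional_calculusP hf /is_functional_calculusP hg fg.
apply: funext => x; apply/eqP; rewrite -subr_eq0; apply/eqP/hnorm_eq0/eqP.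
rewrite eq_le hnorm_ge0 andbT; apply/ler_addgt0Pr => /= e e0; rewrite add0r.
(* Four errors of size [d] add up: two from comparing [p] with [q] through [f = g] on the spectrum,
   one each from [Y] and [Z]. *)
have d0' : 0 < e / (4 * (hnorm x + 1)).
  by rewrite divr_gt0 // mulr_gt0 // ltr_wpDl ?hnorm_ge0.
have [p [pf pY]] := hf _ d0'; have [q [qg qZ]] := hg _ d0'.
set d := e / _ in pf pY qg qZ d0'.
have pq : opbound (poly_op (p - q) X) (d + d).
  apply: poly_op_spectral_bound => //; first by rewrite addr_ge0 ?ltW.
  move=> l sl; rewrite !hornerE.
  have -> : p.[l] - q.[l] = (f l - q.[l]) - (f l - p.[l]).
    by rewrite opprB [RHS]addrC addrA subrK.
  by apply: le_trans (ler_normB _ _) _; rewrite lerD ?pf // fg // qg.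
have -> : Y x - Z x = poly_op (p - q) X x - (poly_op p X - Y) x
   + (poly_op q X - Z) x.
  rewrite poly_opB //; last exact: bounded_operator_linear.
  rewrite -[(poly_op p X - Y) x]/(poly_op p X x - Y x).
  rewrite -[(poly_op q X - Z) x]/(poly_op q X x - Z x).
  move: (Y x) (Z x) (poly_op p X x) (poly_op q X x) => y z a b.
  by rewrite opprB (addrC (a - b)) !addrA !subrK.
apply: le_trans (hnorm_triangle _ _) _.
apply: le_trans (lerD (hnorm_triangle _ _) (lexx _)) _; rewrite hnorm_opp.
apply: le_trans (lerD (lerD (pq x) (pY x)) (qZ x)) _.
have -> : e = (d + d + d + d) * (hnorm x + 1).
  by rewrite /d; field; rewrite gt_eqF // ltr_wpDl ?hnorm_ge0.
apply: (@le_trans _ _ ((d + d + d + d) * hnorm x)); first by rewrite !mulrDl.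
by rewrite ler_wpM2l ?lerDl // !addr_ge0 // ltW.
Qed.

Lemma functional_calculus_selfadjoint_linear f Y : is_functional_calculus X f Y ->
  linear Y /\ selfadjoint Y.
Proof.
move=> /is_functional_calculusP h.
have sm (a b : R) : 0 <= b ->
    (forall e : R, 0 < e -> `|a| <= e * b) -> a = 0.
  move=> b0 hab; apply/normr0_eq0/eqP; rewrite eq_le normr_ge0 andbT.
  apply/ler_addgt0Pr => /= e e0; rewrite add0r.
  have b1 : 0 < b + 1 by rewrite ltr_wpDl.
  apply: le_trans (hab (e / (b + 1)) _) _; first by rewrite divr_gt0.
  by rewrite mulrAC ler_pdivrMr // ler_pM2l // lerDl.
have Xl := bounded_operator_linear Xb.
have Yl : linear Y.
  move=> a u v; apply/eqP; rewrite -subr_eq0; apply/eqP/hnorm_eq0.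
  have c0 : 0 <= complex.Re `|a| by rewrite -ler0c RRe_real ?normr_real.
  apply: (sm _ (hnorm (a *: u + v) + complex.Re `|a| * hnorm u + hnorm v)).
    by rewrite !addr_ge0 ?mulr_ge0 ?hnorm_ge0.
  move=> e e0; rewrite ger0_norm ?hnorm_ge0 //; have [p [_ pY]] := h e e0.
  have pl : linear (poly_op p X) by apply/bounded_operator_linear/poly_op_bounded.
  have -> : Y (a *: u + v) - (a *: Y u + Y v) =
    a *: (poly_op p X - Y) u + (poly_op p X - Y) v - (poly_op p X - Y) (a *: u + v).
    rewrite -[(poly_op p X - Y) _]/(_ - Y _) -[(poly_op p X - Y) v]/(_ - Y v).
    rewrite -[(poly_op p X - Y) (_ + _)]/(_ - Y (_ + _)).
    rewrite pl scalerBr addrACA -[X in _ + X - _]opprD opprB.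
    by rewrite [RHS]addrC [RHS]addrA subrK.
  apply: le_trans (hnorm_triangle _ _) _; rewrite hnorm_opp.
  apply: le_trans (lerD (hnorm_triangle _ _) (lexx _)) _; rewrite hnormZ.
  apply: le_trans (lerD (lerD (ler_wpM2l c0 (pY u)) (pY v)) (pY _)) _.
  by rewrite le_eqVlt; apply/orP; left; apply/eqP; ring.
split=> //.
suff hr x y : rinner (Y x) y = rinner x (Y y).
  by move=> x y; apply: inner_rinner; rewrite hr // linearfZ.
apply/eqP; rewrite -subr_eq0; apply/eqP.
apply: (sm _ (hnorm x * hnorm y *+ 2)); first by rewrite mulrn_wge0 ?mulr_ge0 ?hnorm_ge0.
move=> e e0; have [p [_ pY]] := h e e0.
have -> : rinner (Y x) y - rinner x (Y y) =
  rinner x ((poly_op p X - Y) y) - rinner ((poly_op p X - Y) x) y.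
  rewrite -[(poly_op p X - Y) x]/(_ - Y x) -[(poly_op p X - Y) y]/(_ - Y y).
  rewrite rinnerDl rinnerDr rinnerNl rinnerNr.
  by rewrite (selfadjoint_rinner _ _ (poly_op_selfadjoint p Xl Xs)); ring.
apply: le_trans (ler_normB _ _) _.
rewrite mulr2n mulrDr lerD //; apply: le_trans (cauchy_schwarz _ _) _.
  by rewrite mulrCA ler_wpM2l ?hnorm_ge0.
by rewrite mulrA ler_wpM2r ?hnorm_ge0.
Qed.

Lemma functional_calculus_poly (p : {poly R}) :
  is_functional_calculus X (fun l => p.[l]) (poly_op p X).
Proof.
apply/is_functional_calculusP => e e0; exists p; split=> [l _|x].
  by rewrite subrr normr0 ltW.
rewrite -[(_ - _) x]/(poly_op p X x - poly_op p X x) subrr hnorm0.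
by rewrite mulr_ge0 ?hnorm_ge0 // ltW.
Qed.

Lemma functional_calculusM f g Y Z (F G : R) :
  is_functional_calculus X f Y -> is_functional_calculus X g Z ->
  0 <= F -> (forall l, spectrum X l%:C -> `|f l| <= F) ->
  0 <= G -> (forall l, spectrum X l%:C -> `|g l| <= G) ->
  is_functional_calculus X (fun l => f l * g l) (Y \o Z).
Proof.
move=> fY gZ F0 hF G0 hG; have Xl := bounded_operator_linear Xb.
have ZG := functional_calculus_opbound gZ G0 hG.
have [Yl _] := functional_calculus_selfadjoint_linear fY.
move/is_functional_calculusP: fY => fY; move/is_functional_calculusP: gZ => gZ.
apply/is_functional_calculusP => e e0.
(* The error of the product is at most [(F + d) d + d G], and [d <= 1] bounds this by
   [d (F + G + 1) <= e]. *)
set d := Num.min 1 (e / (F + G + 1)).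
have FG : 0 < F + G + 1 by rewrite ltr_wpDl ?addr_ge0.
have d0 : 0 < d by rewrite lt_min ltr01 divr_gt0.
have de : d * (F + G + 1) <= e by rewrite -ler_pdivlMr // ge_min lexx orbT.
have d1 : d <= 1 by rewrite ge_min lexx.
have [p [pf pY]] := fY d d0; have [q [qg qZ]] := gZ d d0.
have pF l : spectrum X l%:C -> `|p.[l]| <= F + d.
  move=> sl; rewrite -[p.[l]](subrK (f l)) addrC.
  apply: le_trans (ler_normD _ _) _; apply: lerD; first exact: hF.
  by rewrite distrC; apply: pf.
have dd : (F + d) * d + d * G <= e.
  apply: le_trans de; rewrite mulrC -mulrDr ler_pM2l //; lra.
exists (p * q); split=> [l sl|x].
  rewrite hornerM.
  have -> : f l * g l - p.[l] * q.[l] =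
    p.[l] * (g l - q.[l]) + (f l - p.[l]) * g l by ring.
  apply: le_trans (ler_normD _ _) _; rewrite !normrM; apply: le_trans dd.
  by apply: lerD; apply: ler_pM; rewrite ?pF ?qg ?pf ?hG.
have pl : linear (poly_op p X) by apply/bounded_operator_linear/poly_op_bounded.
have -> : (poly_op (p * q) X - (Y \o Z)) x =
   poly_op p X ((poly_op q X - Z) x) + (poly_op p X - Y) (Z x).
  rewrite -[LHS]/(poly_op (p * q) X x - Y (Z x)) poly_opM //.
  rewrite -[(poly_op q X - Z) x]/(_ - Z x) -[(poly_op p X - Y) _]/(_ - Y (Z x)).
  by rewrite (linearfB pl) addrA subrK.
apply: le_trans (hnorm_triangle _ _) _.
apply: le_trans (ler_wpM2r (hnorm_ge0 x) dd); rewrite mulrDl -!mulrA.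
apply: lerD.
  apply: le_trans (poly_op_spectral_bound Xb Xs _ pF _) _.
    by rewrite addr_ge0 // ltW.
  by rewrite ler_wpM2l // addr_ge0 // ltW.
by apply: le_trans (pY _) _; rewrite ler_wpM2l // ltW.
Qed.

(** The spectral bound applied to [p m - p n] makes [p n (X) x] a Cauchy sequence for each [x]; the
    pointwise limit is the witness that [xget] requires. *)
Lemma functional_calculus_exists f :
  (forall e : R, 0 < e -> exists p : {poly R},
     forall l, spectrum X l%:C -> `|f l - p.[l]| <= e) ->
  is_functional_calculus X f (functional_calculus X f).
Proof.
move=> hf; have Xl := bounded_operator_linear Xb.
suff [Y hY] : exists Y, is_functional_calculus X f Y by apply: (@xgetI _ _ _ Y).
have /choice[p hp] : forall n : nat, exists p : {poly R},
    (forall l, spectrum X l%:C -> `|f l - p.[l]| <= n.+1%:R^-1).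
  by move=> n; apply: hf; rewrite invr_gt0.
have hpq m n x : hnorm (poly_op (p m) X x - poly_op (p n) X x) <=
    (m.+1%:R^-1 + n.+1%:R^-1) * hnorm x.
  rewrite -poly_opB //; apply: poly_op_spectral_bound => //.
  move=> l sl; rewrite !hornerE.
  have -> : (p m).[l] - (p n).[l] = (f l - (p n).[l]) - (f l - (p m).[l]).
    by rewrite opprB [RHS]addrC addrA subrK.
  by apply: le_trans (ler_normB _ _) _; rewrite addrC lerD ?hp.
have /choice[Y hY] : forall x, exists y, forall e : R, 0 < e -> exists N : nat,
     forall n, (N <= n)%N -> hnorm (y - poly_op (p n) X x) < e.
  move=> x; apply: hilbert_complete => e e0.
  have x1 : 0 < hnorm x + 1 by rewrite ltr_wpDl ?hnorm_ge0.
  have [|N hN] := @natSinv_lt _ (e / 2 / (hnorm x + 1)); first by rewrite !divr_gt0.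
  exists N => m n /hN hm /hN hn; apply: le_lt_trans (hpq m n x) _.
  have : (m.+1%:R^-1 + n.+1%:R^-1) * (hnorm x + 1) < e.
    rewrite -ltr_pdivlMr //.
    have -> : e / (hnorm x + 1) = e / 2 / (hnorm x + 1) + e / 2 / (hnorm x + 1).
      by rewrite -mulrDl -splitr.
    exact: ltrD.
  by apply: le_lt_trans; rewrite ler_wpM2l ?lerDl ?addr_ge0 ?invr_ge0.
exists Y; apply/is_functional_calculusP => e e0.
have e20 : 0 < e / 2 by rewrite divr_gt0.
have [N hN] := natSinv_lt e20; exists (p N); split=> [l sl|x].
  apply: le_trans (hp N l sl) _; apply: ltW; apply: lt_le_trans (hN N _) _ => //.
  by rewrite ler_pdivrMr // mulr_natr mulr2n lerDl ltW.
apply/ler_addgt0Pr => d d0.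
have [N' hN'] := hY x d d0; pose M := maxn N N'.
have h1 := hN' M (leq_maxr _ _); have h2 := hpq N M x.
have hM := hN M (leq_maxl _ _); have hNN := hN N (leqnn _).
have -> : (poly_op (p N) X - Y) x = (poly_op (p N) X x - poly_op (p M) X x)
   - (Y x - poly_op (p M) X x).
  by rewrite opprB addrA subrK.
apply: le_trans (hnorm_triangle _ _) _; rewrite hnorm_opp lerD ?(ltW h1) //.
apply: le_trans h2 _; rewrite ler_wpM2r ?hnorm_ge0 // [leRHS]splitr.
by rewrite lerD // ltW.
Qed.

End Calculus.
End FunctionalCalculus.

(** * Uniform polynomial approximation of real powers on a compact interval *)

Section Weierstrass.
Context {R : realType}.

(* Bernstein polynomials: [(bernstein n f).[x]] is the expectation of [f] at a
   binomial variable with parameters [n] and [x], conditioned on the first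
   trial. *)
Fixpoint bernstein (n : nat) (f : nat -> R) : {poly R} :=
  if n is m.+1 then (1 - 'X) * bernstein m f + 'X * bernstein m (f \o succn)
  else (f 0)%:P.

(** For [x] in [[0, 1]] the weights [1 - x] and [x] are nonnegative with sum 1, so the expectation
    fixes constants and is monotone. *)
Lemma bernstein_dist n (f g : nat -> R) c x :
  0 <= x <= 1 -> (forall k, (k <= n)%N -> `|f k - c| <= g k) ->
  `|(bernstein n f).[x] - c| <= (bernstein n g).[x].
Proof.
move=> /andP[x0 x1]; elim: n f g => [|n IH] f g h /=.
  by rewrite !hornerC h.
rewrite !hornerE.
have -> : (1 - x) * (bernstein n f).[x] + x * (bernstein n (f \o succn)).[x] - c
  = (1 - x) * ((bernstein n f).[x] - c) +
    x * ((bernstein n (f \o succn)).[x] - c) by ring.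
have x1' : 0 <= 1 - x by rewrite subr_ge0.
apply: le_trans (ler_normD _ _) _; rewrite !normrM (ger0_norm x0) (ger0_norm x1').
apply: lerD; apply: ler_wpM2l => //; apply: IH => k kn; apply: h => //.
exact: leqW.
Qed.

(** Second moment about [c] of a binomial variable: variance [n x (1 - x)] plus the square of mean
    minus [c]. *)
Lemma bernstein_sqr n (a b c x : R) :
  (bernstein n (fun k => a + b * (k%:R - c) ^+ 2)).[x] =
  a + b * (n%:R * (x * (1 - x)) + (n%:R * x - c) ^+ 2).
Proof.
elim: n c => [|n IH] c /=; first by rewrite hornerC; ring.
rewrite hornerD !hornerM hornerD hornerN hornerC hornerX IH.
have -> : (fun k => a + b * (k%:R - c) ^+ 2) \o succn =
   (fun k => a + b * (k%:R - (c - 1)) ^+ 2).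
  by apply: funext => k /=; rewrite -natr1 opprB addrA.
by rewrite IH -natr1; ring.
Qed.

Lemma lipschitz_approx01 (f : R -> R) (L e : R) : 0 < L -> 0 < e ->
  (forall x y : R, 0 <= x <= 1 -> 0 <= y <= 1 -> `|f x - f y| <= L * `|x - y|) ->
  exists p : {poly R}, forall x : R, 0 <= x <= 1 -> `|f x - p.[x]| <= e.
Proof.
move=> L0 e0 fL.
(* With [u = |k / N - x|], the bound [u <= eta + u^2 / eta] replaces the absolute value by a second
   moment. The first term contributes [L eta = e / 2]; the second has expectation at most
   [L / (eta N)], and [n] is chosen to make this at most [e / 2]. *)
pose eta := e / (2 * L).
have eta0 : 0 < eta by rewrite divr_gt0 // mulr_gt0.
have [|n hn] := @natSinv_lt R (e / 2 * eta / L); first by rewrite !(divr_gt0, mulr_gt0).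
pose N : R := n.+1%:R.
have N0 : 0 < N by rewrite ltr0Sn.
exists (bernstein n.+1 (fun k => f (k%:R / N))) => x x01.
rewrite distrC.
apply: (@le_trans _ _ (bernstein n.+1
  (fun k => L * eta + L / eta / N ^+ 2 * (k%:R - N * x) ^+ 2)).[x]).
  apply: bernstein_dist => // k kn.
  have kN : 0 <= k%:R / N <= 1.
    by rewrite divr_ge0 ?(ltW N0) //= ler_pdivrMr // mul1r ler_nat.
  apply: le_trans (fL _ _ kN x01) _.
  have -> : L * eta + L / eta / N ^+ 2 * (k%:R - N * x) ^+ 2 =
     L * (eta + `|k%:R / N - x| ^+ 2 / eta).
    rewrite real_normK ?num_real //; field; rewrite !gt_eqF //.
  rewrite ler_pM2l //; set u := `|_|.
  have [ue|ue] := leP u eta.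
    by apply: le_trans ue _; rewrite lerDl divr_ge0 ?(ltW eta0) // exprn_ge0 /u.
  apply: (@le_trans _ _ (u ^+ 2 / eta)); last by rewrite lerDr ltW.
  by rewrite ler_pdivlMr // expr2 ler_wpM2l ?normr_ge0 // ltW.
rewrite bernstein_sqr subrr expr0n addr0 /=.
have Le : L * eta = e / 2 by rewrite /eta; field; rewrite gt_eqF.
rewrite Le -/N.
have -> : L / eta / N ^+ 2 * (N * (x * (1 - x))) = x * (1 - x) * (L / eta * N^-1).
  by field; rewrite !gt_eqF.
have hN : L / eta * N^-1 <= e / 2.
  have -> : e / 2 = L / eta * (e / 2 * eta / L) by field; rewrite !gt_eqF.
  by apply: ler_wpM2l; [rewrite divr_ge0 ?ltW|apply/ltW/hn].
have h0 : 0 <= L / eta * N^-1 by apply/ltW/divr_gt0 => //; apply: divr_gt0.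
have x1 : x * (1 - x) <= 1 by case/andP: x01 => *; nra.
have x0 : 0 <= x * (1 - x).
  by case/andP: x01 => *; rewrite mulr_ge0 // subr_ge0.
rewrite [leRHS]splitr lerD2l; apply: le_trans hN.
by rewrite ler_piMl.
Qed.

Lemma lipschitz_approx (f : R -> R) (a b L e : R) : a < b -> 0 < L -> 0 < e ->
  (forall x y : R, a <= x <= b -> a <= y <= b -> `|f x - f y| <= L * `|x - y|) ->
  exists p : {poly R}, forall x, a <= x <= b -> `|f x - p.[x]| <= e.
Proof.
move=> ab L0 e0 fL; have ba : 0 < b - a by rewrite subr_gt0.
have Iab u : 0 <= u <= 1 -> a <= a + (b - a) * u <= b.
  by case/andP=> u0 u1; nra.
have [|x y x01 y01|p hp] := @lipschitz_approx01 (fun u => f (a + (b - a) * u))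
  (L * (b - a)) e _ e0.
- exact: mulr_gt0.
- apply: le_trans (fL _ _ (Iab _ x01) (Iab _ y01)) _.
  rewrite opprD addrACA subrr add0r -mulrBr normrM (gtr0_norm ba).
  by rewrite mulrA.
exists (p \Po ((b - a)^-1 *: ('X - a%:P))) => x /andP[ax xb].
have := hp ((x - a) / (b - a)).
have -> : a + (b - a) * ((x - a) / (b - a)) = x by field; rewrite gt_eqF.
rewrite horner_comp !hornerE mulrC => -> //.
by rewrite mulrC divr_ge0 ?subr_ge0 ?(ltW ab) //= ler_pdivrMr // mul1r lerD2r.
Qed.

Lemma powR_lipschitz (a b r : R) : 0 < a -> a < b ->
  exists2 L : R, 0 < L & forall x y : R, a <= x <= b -> a <= y <= b ->
    `|x `^ r - y `^ r| <= L * `|x - y|.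
Proof.
move=> a0 ab.
have b0 : 0 < b by apply: lt_trans ab.
(* On [[a, b]] the factor [z^(r - 1)] of the derivative is monotone, increasing or decreasing with
   the sign of [r - 1], so the sum of its endpoint values bounds it in both cases. The [+ 1] keeps
   [L] positive when [r = 0]. *)
pose L := `|r| * (a `^ (r - 1) + b `^ (r - 1)) + 1.
have L0 : 0 < L by rewrite ltr_wpDl // mulr_ge0 // addr_ge0 ?powR_ge0.
exists L => //.
suff H x y : x < y -> a <= x <= b -> a <= y <= b ->
    `|x `^ r - y `^ r| <= L * `|x - y|.
  move=> x y hx hy; have [xy|yx|->] := ltgtP x y; first exact: H.
    by rewrite distrC (distrC x); apply: H.
  by rewrite !subrr normr0 mulr0.
move=> xy /andP[ax xb] /andP[ay yb].
have [||c] := @MVT R (fun z : R => z `^ r) (fun z => r * z `^ (r - 1)) x y xy.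
- move=> z; rewrite in_itv /= => /andP[xz _]; apply: is_derive1_powR.
  exact: lt_trans (lt_le_trans a0 ax) xz.
- apply: derivable_within_continuous => z; rewrite in_itv /= => /andP[xz _].
  apply: ex_derive; apply: is_derive1_powR.
  exact: lt_le_trans (lt_le_trans a0 ax) xz.
rewrite in_itv /= => /andP[xc cy] h.
rewrite distrC h normrM distrC ler_wpM2r ?normr_ge0 //.
have ac : a <= c by apply: ltW; apply: le_lt_trans xc.
have cb : c <= b by apply: ltW; apply: lt_le_trans yb.
have c0 : 0 < c by apply: lt_le_trans ac.
rewrite normrM (ger0_norm (powR_ge0 _ _)) /L.
apply: ler_wpDr => //; apply: ler_wpM2l => //.
have [r1|r1] := leP 0 (r - 1).
  apply: ler_wpDl; first exact: powR_ge0.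
  by apply: ge0_ler_powR => //; rewrite nnegrE ltW.
apply: ler_wpDr; first exact: powR_ge0.
rewrite -[r - 1]opprK (powRN a) (powRN c) lef_pV2 ?posrE ?powR_gt0 //.
by apply: ge0_ler_powR => //; rewrite ?nnegrE ?oppr_ge0 ltW.
Qed.

End Weierstrass.

(** * Real powers of positive invertible operators *)

Section Power.
Context {R : realType}.
Implicit Types H : hilbertType R.

Definition bounded_below H (X : H -> H) : Prop :=
  exists2 c : R, 0 < c & forall x, c * hnorm x <= hnorm (X x).

(** Invertibility is recorded as a lower bound, which passes to conjugates [S X S] without
    exhibiting an inverse. *)
Definition posdef H (X : H -> H) : Prop :=
  [/\ bounded_operator X, positive_op X & bounded_below X].

Lemma posdef_invertible H (X : H -> H) :
  [/\ bounded_operator X, positive_op X & invertible_op X] -> posdef X.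
Proof.
move=> [Xb Xp [Y [/bounded_operatorP[Yl [M M0 YM]] XY YX]]]; split=> //.
exists M^-1 => [|x]; first by rewrite invr_gt0.
rewrite ler_pdivrMl //; apply: le_trans (YM _).
by rewrite -[Y _]/((Y \o X) x) YX.
Qed.

Lemma positive_rinner H (X : H -> H) x : positive_op X -> 0 <= rinner (X x) x.
Proof. by move=> Xp; have := Xp x; rewrite lecE => /andP[_]. Qed.

Lemma positive_opP H (X : H -> H) : selfadjoint X ->
  (forall x, 0 <= rinner (X x) x) -> positive_op X.
Proof.
move=> Xs h x; rewrite lecE; apply/andP; split; last exact: h.
by rewrite selfadjoint_inner_real.
Qed.

Lemma posdef_spectrum H (X : H -> H) : posdef X ->
  exists a b : R, [/\ 0 < a, a < b &
    forall l, spectrum X l%:C -> a <= l <= b].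
Proof.
move=> [Xb Xp [c c0 Xc]].
have Xs : selfadjoint X by apply: positive_op_selfadjoint => //; case: Xb.
have /bounded_operatorP[Xl [M M0 XM]] := Xb.
(* Negative [l] are excluded by positivity, [0 <= l < c] by the lower bound on [X], and [l > c + M]
   by the upper bound [M]. Adding [c] to [M] leaves the margin [c] as a lower bound for [l - X] and
   makes the interval nondegenerate. *)
exists c, (c + M); split=> // [|l]; first by rewrite ltrDl.
move=> sl; have notin d : 0 < d ->
    (forall x, d * hnorm x <= hnorm (l%:C *: x - X x)) -> False.
  by move=> d0 hd; have /spectrumP : exists2 c : R, 0 < c &
    forall x, c * hnorm x <= hnorm (l%:C *: x - X x); [exists d|apply].
apply/andP; split; rewrite leNgt; apply/negP => lc.
- have [l0|l0] := ltP l 0.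
    apply: (notin (- l)) => [|x]; first by rewrite oppr_gt0.
    have [/hnorm_eq0 ->|xn0] := eqVneq (hnorm x) 0.
      by rewrite hnorm0 mulr0 hnorm_ge0.
    have x0 : 0 < hnorm x by rewrite lt_neqAle eq_sym xn0 hnorm_ge0.
    rewrite -(ler_pM2r x0).
    apply: le_trans (cauchy_schwarz (l%:C *: x - X x) x).
    rewrite rinnerDl rinnerNl rinnerZl rinner_hnorm -normrN.
    apply: le_trans (ler_norm _); rewrite opprB !mulNr.
    by rewrite -mulrA -expr2 lerDr positive_rinner.
  apply: (notin (c - l)) => [|x]; first by rewrite subr_gt0.
  rewrite mulrBl lerBlDr hdistC.
  have -> : l * hnorm x = hnorm (l%:C *: x) by rewrite hnormZr ger0_norm.
  apply: le_trans (Xc x) _.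
  by rewrite -{1}[X x](subrK (l%:C *: x)) hnorm_triangle.
- apply: (notin c) => // x.
  have l0 : 0 < l by apply: lt_trans lc; rewrite addr_gt0.
  have -> : c * hnorm x = (c + M) * hnorm x - M * hnorm x by ring.
  rewrite lerBlDr; apply: le_trans (ler_wpM2r (hnorm_ge0 x) (ltW lc)) _.
  have -> : l * hnorm x = hnorm (l%:C *: x) by rewrite hnormZr gtr0_norm.
  apply: le_trans (lerD (lexx _) (XM x)).
  by rewrite -{1}[l%:C *: x](subrK (X x)) hnorm_triangle.
Qed.

Section OpPower.
Variables (H : hilbertType R) (X : H -> H).
Hypothesis Xpos : posdef X.

Let Xb : bounded_operator X. Proof. by case: Xpos. Qed.
Let Xs : selfadjoint X.
Proof. by case: Xpos => Xb' Xp _; apply: positive_op_selfadjoint => //; case: Xb'. Qed.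

Lemma op_power_calculus r :
  is_functional_calculus X (fun l => l `^ r) (op_power X r).
Proof.
apply: functional_calculus_exists => // e e0.
have [a [b [a0 ab hs]]] := posdef_spectrum Xpos.
have [L L0 hL] := powR_lipschitz r a0 ab.
have [p hp] := lipschitz_approx ab L0 e0 hL.
by exists p => l /hs; apply: hp.
Qed.

Lemma powR_spectrum_bound r :
  exists2 M : R, 0 <= M & forall l, spectrum X l%:C -> `|l `^ r| <= M.
Proof.
have [a [b [a0 ab hs]]] := posdef_spectrum Xpos.
have [L L0 hL] := powR_lipschitz r a0 ab.
exists (`|a `^ r| + L * (b - a)) => [|l /hs hl].
  by rewrite addr_ge0 // mulr_ge0 ?subr_ge0 // ltW.
rewrite -[l `^ r](subrK (a `^ r)) addrC; apply: le_trans (ler_normD _ _) _.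
rewrite lerD2l; apply: le_trans (hL _ _ hl _) _; first by rewrite lexx ltW.
case/andP: hl => al lb; rewrite ler_wpM2l ?(ltW L0) //.
by rewrite ger0_norm ?subr_ge0 // lerD2r.
Qed.

Lemma op_power_bounded r : bounded_operator (op_power X r).
Proof.
have h := op_power_calculus r.
have [M M0 hM] := powR_spectrum_bound r.
apply/bounded_operatorP; split.
  exact: (functional_calculus_selfadjoint_linear Xb Xs h).1.
exists (M + 1) => [|x]; first by rewrite ltr_wpDl.
have := functional_calculus_opbound Xb Xs h _ hM; move=> /(_ M0) hx.
by apply: le_trans (hx x) _; rewrite ler_wpM2r ?hnorm_ge0 // lerDl.
Qed.

Lemma op_power_selfadjoint r : selfadjoint (op_power X r).
Proof. exact: (functional_calculus_selfadjoint_linear Xb Xs (op_power_calculus r)).2. Qed.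

Lemma op_powerD r s x : op_power X r (op_power X s x) = op_power X (r + s) x.
Proof.
have [M M0 hM] := powR_spectrum_bound r.
have [N N0 hN] := powR_spectrum_bound s.
have h := functional_calculusM Xb Xs (op_power_calculus r) (op_power_calculus s)
  M0 hM N0 hN.
rewrite -(functional_calculus_unique Xb Xs h (op_power_calculus (r + s))) //.
move=> l sl; have [a [b [a0 ab hs]]] := posdef_spectrum Xpos.
have /andP[al _] := hs l sl.
by rewrite powRD //; apply/implyP => _; rewrite gt_eqF // (lt_le_trans a0).
Qed.

Lemma op_power0 x : op_power X 0 x = x.
Proof.
have := functional_calculus_poly X 1%:P => h.
rewrite (functional_calculus_unique Xb Xs (op_power_calculus 0) h).
  by rewrite poly_opC rmorph1 scale1r.
by move=> l _; rewrite powRr0 hornerC.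
Qed.

Lemma op_power1 x : op_power X 1 x = X x.
Proof.
have := functional_calculus_poly X 'X => h.
rewrite (functional_calculus_unique Xb Xs (op_power_calculus 1) h).
  by rewrite poly_opX //; case: Xb.
move=> l sl; have [a [b [a0 ab hs]]] := posdef_spectrum Xpos.
have /andP[al _] := hs l sl.
by rewrite hornerX powRr1 // (le_trans (ltW a0)).
Qed.

(** For [r] in [[0, 1]], [l^r] is at most the larger of 1 and [l]. Uniformity in [r] is what
    midpoint convexity needs in order to imply convexity. *)
Lemma op_power_uniform_bound :
  exists2 M : R, 0 <= M & forall r, 0 <= r <= 1 -> opbound (op_power X r) M.
Proof.
have [a [b [a0 ab hs]]] := posdef_spectrum Xpos.
have b0 : 0 < b by apply: lt_trans ab.
exists (1 + b) => [|r /andP[r0 r1]]; first by rewrite addr_ge0 ?(ltW b0).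
apply: (functional_calculus_opbound Xb Xs (op_power_calculus r)).
  by rewrite addr_ge0 ?(ltW b0).
move=> l /hs /andP[al lb]; rewrite ger0_norm ?powR_ge0 //.
have l0 : 0 < l by apply: lt_le_trans al.
have [l1|l1] := leP l 1.
  apply: (@le_trans _ _ 1); last by rewrite lerDl ltW.
  by rewrite -[leRHS](powRr0 l); apply: ger_powR => //; rewrite l0.
apply: (@le_trans _ _ l); last by apply: le_trans lb _; rewrite lerDr.
by apply: ler1_powR => //; apply: ltW.
Qed.

Lemma op_power_bounded_below r : bounded_below (op_power X r).
Proof.
have /bounded_operatorP[_ [M M0 hM]] := op_power_bounded (- r).
exists M^-1 => [|x]; first by rewrite invr_gt0.
rewrite ler_pdivrMl //; apply: le_trans (hM _).
by rewrite op_powerD addNr op_power0.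
Qed.

End OpPower.

Lemma posdef_conjugate H (S X : H -> H) :
  bounded_operator S -> selfadjoint S -> bounded_below S -> posdef X ->
  posdef (S \o X \o S).
Proof.
move=> Sb Ss [c c0 hc] [Xb Xp [d d0 hd]]; split.
- by do 2?[apply: bounded_operator_comp => //].
- by move=> x /=; rewrite Ss; apply: Xp.
exists (c * (d * c)) => [|x /=]; first by rewrite !mulr_gt0.
apply: le_trans (hc _); rewrite -mulrA ler_pM2l //.
by apply: le_trans (hd _); rewrite -mulrA ler_pM2l.
Qed.

(* [S = (4 M^2 - X^2)^(1/2)], so that [|(X (x) 1) v| <= 2 M |v|] amounts to
   [0 <= |(S (x) 1) v|^2]. *)
Lemma sqrt_defect H (X : H -> H) (M : R) :
  bounded_operator X -> selfadjoint X -> 0 < M -> opbound X M ->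
  exists S : H -> H, forall x y,
    inner (S x) (S y) = ((2 * M) ^+ 2)%:C * inner x y - inner (X x) (X y).
Proof.
move=> Xb Xs M0 XM; have Xl := bounded_operator_linear Xb.
pose T : H -> H := ((2 * M) ^+ 2)%:C *: (fun x => x) - (X \o X).
have TE x : T x = ((2 * M) ^+ 2)%:C *: x - X (X x) by [].
have Tin x : 3 * M ^+ 2 * hnorm x ^+ 2 <= rinner (T x) x.
  rewrite TE rinnerDl rinnerNl rinnerZl rinner_hnorm selfadjoint_rinner //.
  rewrite rinner_hnorm.
  have : hnorm (X x) ^+ 2 <= (M * hnorm x) ^+ 2.
    by rewrite ler_pXn2r ?nnegrE ?mulr_ge0 ?hnorm_ge0 ?(ltW M0).
  by rewrite !exprMn; lra.
have Tb : bounded_operator T.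
  apply: bounded_operatorB; last exact: bounded_operator_comp.
  by apply: bounded_operatorZ; apply: bounded_operator_id.
have Ts : selfadjoint T.
  move=> x y; rewrite !TE linearBl linearBr /= !Xs; congr (_ - _).
  rewrite linearZl_LR linearZr_LR /=; congr (_ * _).
  exact/esym/conjc_real.
have M3 : 0 < 3 * M ^+ 2 by rewrite mulr_gt0 // exprn_gt0.
have Tpos : posdef T.
  split=> //.
    apply: positive_opP => // x; apply: le_trans (Tin x).
    by rewrite mulr_ge0 ?exprn_ge0 ?hnorm_ge0 // ltW.
  exists (3 * M ^+ 2) => // x.
  have [/hnorm_eq0 ->|xn0] := eqVneq (hnorm x) 0.
    by rewrite hnorm0 mulr0 hnorm_ge0.
  have x0 : 0 < hnorm x by rewrite lt_neqAle eq_sym xn0 hnorm_ge0.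
  rewrite -(ler_pM2r x0); apply: le_trans (cauchy_schwarz (T x) x).
  apply: le_trans (ler_norm _); apply: le_trans (Tin x).
  by rewrite expr2 !mulrA.
exists (op_power T 2^-1) => x y.
rewrite -op_power_selfadjoint // op_powerD //.
have -> : 2^-1 + 2^-1 = 1 :> R by rewrite [RHS]splitr mul1r.
by rewrite op_power1 // TE linearBl linearZl_LR /= Xs.
Qed.

End Power.

(** * Extending bounded maps from a dense span *)

Section Extension.
Context {R : realType}.
Implicit Types H K : hilbertType R.

(** Combinations are formal lists of coefficients and indices, so that one list can be evaluated in
    two families of vectors before any map between their spans is known to be well defined. *)
Definition lincomb H (I : Type) (u : I -> H) (s : seq (R[i] * I)) : H :=
  \sum_(z <- s) z.1 *: u z.2.

Lemma lincomb_cat H (I : Type) (u : I -> H) s t :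
  lincomb u (s ++ t) = lincomb u s + lincomb u t.
Proof. by rewrite /lincomb big_cat. Qed.

Definition scale_coefs (I : Type) (a : R[i]) (s : seq (R[i] * I)) :=
  [seq (a * z.1, z.2) | z <- s].

Lemma lincomb_scale H (I : Type) (u : I -> H) a s :
  lincomb u (scale_coefs a s) = a *: lincomb u s.
Proof.
rewrite /lincomb big_map scaler_sumr; apply: eq_bigr => z _ /=.
by rewrite scalerA.
Qed.

Lemma linear_span_lincomb H (I : Type) (u : I -> H) x :
  linear_span (range u) x -> exists s, x = lincomb u s.
Proof.
move=> [m [c [w [hw ->]]]].
have /choice[j hj] : forall i, exists j, u j = w i.
  by move=> i; have [j _] := hw i; exists j.
exists [seq (c i, j i) | i <- enum 'I_m].
by rewrite /lincomb big_map big_enum; apply: eq_bigr => i _ /=; rewrite hj.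
Qed.

Lemma dense_lincomb H (I : Type) (u : I -> H) :
  closure (linear_span (range u)) = setT ->
  closure [set lincomb u s | s in [set: seq (R[i] * I)]] = setT.
Proof.
move=> cu; apply/seteqP; split=> // x _; have : closure (linear_span (range u)) x.
  by rewrite cu.
by apply: closure_subset => y /linear_span_lincomb[s ->]; exists s.
Qed.

(** Applied to the formal difference of two lists, the bound shows both that the value depends only
    on the vector represented and that approximating sequences have Cauchy images. *)
Lemma lincomb_extension H K (I : Type) (u : I -> H) (w : I -> K) (M : R) :
  0 <= M ->
  closure (linear_span (range u)) = setT ->
  (forall s, hnorm (lincomb w s) <= M * hnorm (lincomb u s)) ->
  exists T : H -> K, [/\ linear T, opbound T M &
    forall s, T (lincomb u s) = lincomb w s].
Proof.
move=> M0 /dense_lincomb cu hw.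
have hB s t : hnorm (lincomb w s - lincomb w t) <=
    M * hnorm (lincomb u s - lincomb u t).
  have := hw (s ++ scale_coefs (-1) t).
  by rewrite !lincomb_cat !lincomb_scale !scaleN1r.
have M1 : 0 < M + 1 by rewrite ltr_wpDl.
(* The image of [x] is characterised by its distance to all approximants at once; the values on the
   span, linearity and the norm bound all follow from this inequality. *)
have hex x : exists y, forall s, hnorm (y - lincomb w s) <=
    M * hnorm (x - lincomb u s).
  have /choice[s hs] : forall n : nat, exists s, hnorm (x - lincomb u s) < n.+1%:R^-1.
    move=> n; have n0 : 0 < n.+1%:R^-1 :> R by rewrite invr_gt0.
    by have [_ [s _ <-] h] := closure_hnorm cu x n0; exists s.
  have tri a b : hnorm (lincomb u a - lincomb u b) <=
      hnorm (x - lincomb u a) + hnorm (x - lincomb u b).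
    have -> : lincomb u a - lincomb u b = (x - lincomb u b) - (x - lincomb u a).
      by rewrite opprB [RHS]addrC addrA subrK.
    by apply: le_trans (hnorm_triangle _ _) _; rewrite hnorm_opp addrC.
  have [e e0|y hy] := @hilbert_complete _ _ (fun n => lincomb w (s n)).
    have [|N hN] := @natSinv_lt R (e / 2 / (M + 1)); first by rewrite !divr_gt0.
    exists N => m n /hN hm /hN hn; apply: le_lt_trans (hB _ _) _.
    have h : hnorm (lincomb u (s m) - lincomb u (s n)) < e / (M + 1).
      apply: le_lt_trans (tri _ _) _.
      have -> : e / (M + 1) = e / 2 / (M + 1) + e / 2 / (M + 1).
        by rewrite -mulrDl -splitr.
      by apply: ltrD; [apply: lt_trans (hs m) hm|apply: lt_trans (hs n) hn].
    move: h; rewrite ltr_pdivlMr // mulrC; apply: le_lt_trans.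
    by rewrite ler_wpM2r ?hnorm_ge0 // lerDl.
  exists y => t; apply/ler_addgt0Pr => e e0.
  have e20 : 0 < e / 2 / (M + 1) by rewrite !divr_gt0.
  have [N1 h1] := hy _ e20; have [N2 h2] := natSinv_lt e20.
  pose n := maxn N1 N2.
  have := h1 n (leq_maxl _ _); have := lt_trans (hs n) (h2 n (leq_maxr _ _)).
  set d := e / 2 / (M + 1) => hd1 hd2.
  have dM : d * (M + 1) = e / 2 by rewrite /d divfK // gt_eqF.
  have d0 : 0 <= d by apply: ltW.
  rewrite -[y - _](subrK (lincomb w (s n) - lincomb w t)).
  apply: le_trans (hnorm_triangle _ _) _.
  have -> : y - lincomb w t - (lincomb w (s n) - lincomb w t) = y - lincomb w (s n).
    by rewrite opprB addrA subrK.
  have h3 := hB (s n) t; have h4 := ler_wpM2l M0 (tri (s n) t).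
  have h5 := ler_wpM2l M0 (ltW hd1).
  have Md : M * d + d = e / 2 by rewrite -dM mulrDr mulr1 mulrC.
  rewrite mulrDr in h4; lra.
have /choice[T hT] := hex.
have TE s : T (lincomb u s) = lincomb w s.
  apply/eqP; rewrite -subr_eq0; apply/eqP/hnorm_eq0/eqP.
  rewrite eq_le hnorm_ge0 andbT; apply: le_trans (hT _ s) _.
  by rewrite subrr hnorm0 mulr0.
exists T; split=> //.
  move=> a x y; apply/eqP; rewrite -subr_eq0; apply/eqP/hnorm_eq0/eqP.
  rewrite eq_le hnorm_ge0 andbT; apply/ler_addgt0Pr => e e0; rewrite add0r.
  have A0 : 0 <= complex.Re `|a| by rewrite -ler0c RRe_real ?normr_real.
  (* Approximating [x] and [y] within [d] leaves a linearity defect of at most [2 M (|a| + 1) d]. *)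
  pose D : R := 2 * M * (complex.Re `|a| + 1) + 1.
  have D0 : 0 < D by rewrite ltr_wpDl // !mulr_ge0 // addr_ge0.
  have d0 : 0 < e / D by rewrite divr_gt0.
  have [_ [s _ <-] hs] := closure_hnorm cu x d0.
  have [_ [t _ <-] ht] := closure_hnorm cu y d0.
  set d := e / D in hs ht d0.
  have h1 := hT x s; have h2 := hT y t.
  have h3 := hT (a *: x + y) (scale_coefs a s ++ t).
  rewrite !lincomb_cat !lincomb_scale in h3.
  have -> : T (a *: x + y) - (a *: T x + T y) =
     (T (a *: x + y) - (a *: lincomb w s + lincomb w t))
     - (a *: (T x - lincomb w s) + (T y - lincomb w t)).
    have -> : a *: (T x - lincomb w s) + (T y - lincomb w t) =
        (a *: T x + T y) - (a *: lincomb w s + lincomb w t).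
      by rewrite scalerBr opprD addrACA.
    by rewrite opprB addrA subrK.
  apply: le_trans (hnorm_triangle _ _) _; rewrite hnorm_opp.
  apply: le_trans (lerD (lexx _) (hnorm_triangle _ _)) _; rewrite hnormZ.
  apply: le_trans (lerD h3 (lerD (ler_wpM2l A0 h1) h2)) _.
  have h4 : hnorm (a *: x + y - (a *: lincomb u s + lincomb u t)) <=
      complex.Re `|a| * hnorm (x - lincomb u s) + hnorm (y - lincomb u t).
    rewrite opprD addrACA -scalerBr -hnormZ.
    exact: hnorm_triangle.
  apply: le_trans (lerD (ler_wpM2l M0 h4) (lexx _)) _.
  have h5 := ler_wpM2l A0 (ltW hs).
  have h6 : complex.Re `|a| * hnorm (x - lincomb u s) + hnorm (y - lincomb u t) <=
     d * (complex.Re `|a| + 1) by rewrite mulrDr mulr1 (mulrC d); apply/lerD/ltW.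
  rewrite (_ : _ + (_ + _) = 2 * M * (complex.Re `|a| * hnorm (x - lincomb u s)
    + hnorm (y - lincomb u t))); last by ring.
  have M20 : 0 <= 2 * M by rewrite mulr_ge0.
  apply: le_trans (ler_wpM2l M20 h6) _.
  have -> : e = d * D by rewrite /d divfK // gt_eqF.
  rewrite mulrCA ler_wpM2l ?(ltW d0) // /D lerDl //.
(* Comparison with the empty combination, which represents 0, is the norm bound. *)
move=> x; have := hT x [::].
by rewrite /lincomb !big_nil !subr0.
Qed.

End Extension.

(** * Boundedness on finite sums of elementary tensors *)

Section Tensor.
Context {R : realType}.
Variables (H K : hilbertType R) (tau : hilbert_tensor H H K).

Lemma inner_lincomb (L : hilbertType R) (I : Type) (u w : I -> L) s t :
  inner (lincomb u s) (lincomb w t) =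
  \sum_(p <- s) \sum_(q <- t) p.1 * (q.1)^*%C * inner (u p.2) (w q.2).
Proof.
rewrite /lincomb linear_sumlz; apply: eq_bigr => p _.
rewrite linear_sumr; apply: eq_bigr => q _.
by rewrite linearZl_LR linearZr_LR /= mulrA.
Qed.

Lemma tensor_hnorm x y : hnorm (tau x y) = hnorm x * hnorm y.
Proof.
apply/eqP; rewrite -(@eqrXn2 _ 2) ?mulr_ge0 ?hnorm_ge0 //; apply/eqP.
by apply: complexI; rewrite -inner_hnorm tensor_inner !inner_hnorm -rmorphM exprMn.
Qed.

(** The value that [X (x) Y] should take on a formal sum of elementary tensors, available before
    that operator is known to exist. *)
Definition tensor_lincomb (X Y : H -> H) (s : seq (R[i] * (H * H))) : K :=
  lincomb (fun z : H * H => tau (X z.1) (Y z.2)) s.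

(** All three squared norms are double sums over the same pairs of terms, and the relation between
    [S] and [X] applies to each pair while the factor coming from [Y] is common. *)
Lemma tensor_lincomb_defect (X S Y : H -> H) (N : R) s :
  (forall x y, inner (S x) (S y) = N%:C * inner x y - inner (X x) (X y)) ->
  hnorm (tensor_lincomb S Y s) ^+ 2 =
  N * hnorm (tensor_lincomb id Y s) ^+ 2 - hnorm (tensor_lincomb X Y s) ^+ 2.
Proof.
move=> SX; apply: complexI.
rewrite rmorphB /= (rmorphM _ N) /= -!inner_hnorm /tensor_lincomb !inner_lincomb.
rewrite mulr_sumr -sumrB; apply: eq_bigr => p _.
rewrite mulr_sumr -sumrB; apply: eq_bigr => q _.
by rewrite !tensor_inner SX /=; ring.
Qed.

(** The constant is [2 * M] because the square root is available for operators that are bounded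
    below: [4 M^2 - X^2 >= 3 M^2], whereas [M^2 - X^2] may fail to be invertible. *)
Lemma tensor_lincomb_boundl (X : H -> H) :
  bounded_operator X -> selfadjoint X -> exists2 M : R, 0 < M &
  forall Y s, hnorm (tensor_lincomb X Y s) <= M * hnorm (tensor_lincomb id Y s).
Proof.
move=> Xb Xs; have /bounded_operatorP[_ [M M0 XM]] := Xb.
have [S hS] := sqrt_defect Xb Xs M0 XM.
exists (2 * M) => [|Y s]; first exact: mulr_gt0.
rewrite -(@ler_pXn2r _ 2) ?nnegrE ?mulr_ge0 ?hnorm_ge0 ?(ltW M0) //.
rewrite exprMn -subr_ge0 -(tensor_lincomb_defect Y s hS).
by rewrite exprn_ge0 ?hnorm_ge0.
Qed.

End Tensor.

(** * Existence of the tensor product of self-adjoint operators *)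

Section TensorOp.
Context {R : realType}.
Variables (H K : hilbertType R) (tau : hilbert_tensor H H K).

Let flip_dense : closure (linear_span
   [set tau z.2 z.1 | z in [set: H * H]]) = setT.
Proof.
rewrite -(tensor_dense tau); congr (closure (linear_span _)).
by apply/seteqP; split=> _ [[x y] _ <-]; exists (y, x).
Qed.

(** Exchanging the factors turns the bound for the left operator into one for the right operator. *)
Definition flip_tensor : hilbert_tensor H H K.
Proof.
refine (@HilbertTensor _ _ _ _ (fun x y => tau y x) _ _ _ _).
- by move=> x; apply: tensor_linear_r.
- by move=> x; apply: tensor_linear_l.
- by move=> x x' y y'; rewrite tensor_inner mulrC.
- exact: flip_dense.
Defined.

Lemma tensor_lincomb_flip X Y s : tensor_lincomb tau X Y s =
  tensor_lincomb flip_tensor Y X [seq (z.1, (z.2.2, z.2.1)) | z <- s].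
Proof. by rewrite /tensor_lincomb /lincomb big_map. Qed.

Lemma tensor_lincomb_bound (X Y : H -> H) :
  bounded_operator X -> selfadjoint X -> bounded_operator Y -> selfadjoint Y ->
  exists2 M : R, 0 < M & forall s,
    hnorm (tensor_lincomb tau X Y s) <= M * hnorm (tensor_lincomb tau id id s).
Proof.
move=> Xb Xs Yb Ys.
have [M M0 hM] := tensor_lincomb_boundl tau Xb Xs.
have [N N0 hN] := tensor_lincomb_boundl flip_tensor Yb Ys.
exists (M * N) => [|s]; first exact: mulr_gt0.
apply: le_trans (hM Y s) _; rewrite -mulrA ler_pM2l //.
by rewrite !tensor_lincomb_flip hN.
Qed.

Lemma tensor_opP (X Y : H -> H) :
  bounded_operator X -> selfadjoint X -> bounded_operator Y -> selfadjoint Y ->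
  bounded_operator (tensor_op tau X Y) /\
  forall s, tensor_op tau X Y (tensor_lincomb tau id id s) =
    tensor_lincomb tau X Y s.
Proof.
move=> Xb Xs Yb Ys; have [M M0 hM] := tensor_lincomb_bound Xb Xs Yb Ys.
have [T [Tl Tb TE]] := lincomb_extension (ltW M0) (tensor_dense tau) hM.
have : [set T | bounded_operator T /\
    forall x y, T (tau x y) = tau (X x) (Y y)] (tensor_op tau X Y).
  apply: (@xgetI _ _ _ T); split; first by apply/bounded_operatorP; split=> //; exists M.
  move=> x y; have := TE [:: (1, (x, y))].
  by rewrite /lincomb !big_seq1 !scale1r.
move=> [Zb ZE]; split=> // s.
have Zl := bounded_operator_linear Zb.
rewrite /tensor_lincomb /lincomb linearf_sum //; apply: eq_bigr => z _.
by rewrite linearfZ // ZE.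
Qed.

End TensorOp.

(** * The diagonal isometry, its adjoint and the Hadamard form *)

Section Diagonal.
Context {R : realType}.
Variables (H K : hilbertType R) (tau : hilbert_tensor H H K).
Variables (J : Type) (e : J -> H).
Hypothesis he : orthonormal_basis e.

(** The vectors [tau (e j) (e j)] are again orthonormal, so both families have the same Gram
    matrix. *)
Lemma diagonal_lincomb_hnorm s :
  hnorm (lincomb (fun j => tau (e j) (e j)) s) = hnorm (lincomb e s).
Proof.
apply/eqP; rewrite -(@eqrXn2 _ 2) ?hnorm_ge0 //; apply/eqP/complexI.
rewrite -!inner_hnorm !inner_lincomb; apply: eq_bigr => p _; apply: eq_bigr => q _.
rewrite tensor_inner; have [e1 e0 _] := he.
by have [->|/e0 ->] := pselect (p.2 = q.2); rewrite ?e1 ?mulr1 ?mulr0.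
Qed.

Lemma diagonal_isometryP : [/\ linear (diagonal_isometry tau e),
  forall x, hnorm (diagonal_isometry tau e x) = hnorm x &
  forall j, diagonal_isometry tau e (e j) = tau (e j) (e j)].
Proof.
have [_ _ ed] := he.
have [|T [Tl Tb TE]] := lincomb_extension (w := fun j => tau (e j) (e j)) ler01 ed.
  by move=> s; rewrite mul1r diagonal_lincomb_hnorm.
(* The extension only provides [|T x| <= |x|]; the reverse inequality comes from the span, where [T]
   is isometric, by density. *)
have Tn x : hnorm (T x) = hnorm x.
  apply/eqP; rewrite eq_le; apply/andP; split; first by rewrite -[leRHS]mul1r.
  apply/ler_addgt0Pr => /= d d0; have d20 : 0 < d / 2 by rewrite divr_gt0.
  have [_ [s _ <-] hs] := closure_hnorm (dense_lincomb ed) x d20.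
  have h1 := hnorm_triangle (x - lincomb e s) (lincomb e s).
  have h2 := hnorm_triangle (T x) (- T (x - lincomb e s)).
  have h3 := Tb (x - lincomb e s).
  rewrite subrK in h1; rewrite hnorm_opp -linearfB // opprB in h2.
  rewrite addrC subrK TE diagonal_lincomb_hnorm in h2; lra.
have [Ul Un Ue] : [set U | [/\ linear U, forall x, `|U x| = `|x|
    & forall j, U (e j) = tau (e j) (e j)]] (diagonal_isometry tau e).
  apply: (@xgetI _ _ _ T); split=> //; first by move=> x; rewrite !normE Tn.
  by move=> j; have := TE [:: (1, j)]; rewrite /lincomb !big_seq1 !scale1r.
by split=> // x; apply: complexI; rewrite -!normE.
Qed.

Let U := diagonal_isometry tau e.

Lemma diagonal_isometry_bounded : bounded_operator U.
Proof.
have [Ul Un _] := diagonal_isometryP.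
by apply/bounded_operatorP; split=> //; exists 1 => // x; rewrite mul1r Un.
Qed.

Lemma isometry_inner (T : H -> K) : linear T -> (forall x, hnorm (T x) = hnorm x) ->
  forall x y, inner (T x) (T y) = inner x y.
Proof.
move=> Tl Tn; have hr x y : rinner (T x) (T y) = rinner x y.
  have := hnormD_sqr x y; have := hnormD_sqr (T x) (T y).
  by rewrite -linearfD // !Tn; lra.
by move=> x y; apply: inner_rinner; rewrite -?linearfZ ?hr.
Qed.

(** The witness for [adjoint] sends [y] to the preimage under [U] of its orthogonal projection onto
    the range of [U]. *)
Lemma adjoint_diagonal x y : inner (U x) y = inner x (adjoint U y).
Proof.
have [Ul Un _] := diagonal_isometryP.
suff : [set Y | forall x y, inner (U x) y = inner x (Y y)] (adjoint U) by apply.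
have /choice[Y hY] : forall y, exists x, forall z, inner (U z) (y - U x) = 0.
  apply: (least_squares diagonal_isometry_bounded (c := 1)) => // z.
  by rewrite mul1r Un.
apply: (@xgetI _ _ _ Y) => z w; have /eqP := hY w z.
by rewrite linearBr subr_eq0 => /eqP ->; apply: isometry_inner.
Qed.

Lemma inner_hadamard X Y x :
  inner (hadamard tau e X Y x) x = inner (tensor_op tau X Y (U x)) (U x).
Proof.
by rewrite /hadamard /= innerC -adjoint_diagonal -innerC.
Qed.

Lemma positive_op_dense (L : hilbertType R) (D : set L) (T : L -> L) :
  bounded_operator T -> closure D = setT ->
  (forall x, D x -> 0 <= inner (T x) x) -> positive_op T.
Proof.
move=> Tb cD TD x.
have idb := bounded_operator_id L.
(* Density transfers real inequalities, so the vanishing of the imaginary part is treated as two of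
   them, tested against [i x] and [- i x]. *)
have ib : bounded_operator (fun x : L => 'i%C *: x).
  exact: bounded_operatorZ.
have nib : bounded_operator (fun x : L => (- 'i%C) *: x).
  exact: bounded_operatorZ.
have h1 := dense_ge0 cD (rinner_bounded_continuous Tb idb).
have h2 := dense_ge0 cD (rinner_bounded_continuous Tb ib).
have h3 := dense_ge0 cD (rinner_bounded_continuous Tb nib).
have Im0 : complex.Im (inner (T x) x) = 0.
  apply/eqP; rewrite eq_le Im_inner -oppr_ge0 -rinnerNr -scaleNr.
  by rewrite h2 ?h3 // => y Dy; rewrite ?scaleNr ?rinnerNr -Im_inner ger0_Im ?oppr0 ?TD.
rewrite lecE Im0 eqxx h1 // => y Dy.
by have := TD y Dy; rewrite lecE => /andP[].
Qed.

(* On the span of the basis the quadratic form is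
   [\sum c_i c_j^* <X e_i, e_j> <Y e_i, e_j>], which is symmetric in X and Y. *)
Lemma inner_hadamardC X Y x :
  bounded_operator X -> selfadjoint X -> bounded_operator Y -> selfadjoint Y ->
  inner (hadamard tau e X Y x) x = inner (hadamard tau e Y X x) x.
Proof.
move=> Xb Xs Yb Ys; rewrite !inner_hadamard.
have [Ul Un Ue] := diagonal_isometryP; have [_ _ ed] := he.
have Ub := diagonal_isometry_bounded.
have [T1b T1E] := tensor_opP tau Xb Xs Yb Ys.
have [T2b T2E] := tensor_opP tau Yb Ys Xb Xs.
have hs s : inner (tensor_op tau X Y (U (lincomb e s))) (U (lincomb e s)) =
    inner (tensor_op tau Y X (U (lincomb e s))) (U (lincomb e s)).
  have Us : U (lincomb e s) = tensor_lincomb tau id id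
      [seq (z.1, (e z.2, e z.2)) | z <- s].
    rewrite /tensor_lincomb /lincomb big_map linearf_sum //.
    by apply: eq_bigr => z _; rewrite linearfZ // /U Ue.
  rewrite Us T1E T2E /tensor_lincomb !inner_lincomb !big_map.
  apply: eq_bigr => p _; rewrite !big_map; apply: eq_bigr => q _ /=.
  by rewrite !tensor_inner (mulrC (inner (X _) _)).
have TUb : bounded_operator ((tensor_op tau X Y - tensor_op tau Y X) \o U).
  by apply: bounded_operator_comp => //; apply: bounded_operatorB.
have dle S : bounded_operator S ->
    (forall s, inner (S (lincomb e s)) (U (lincomb e s)) = 0) ->
    rinner (S x) (U x) = 0.
  move=> Sb hS; apply/eqP; rewrite eq_le; apply/andP; split.
    rewrite -oppr_ge0 -rinnerNl.
    have Nb : bounded_operator (- S : H -> K).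
      by have := bounded_operatorZ (-1) Sb; rewrite scaleN1r.
    apply: (dense_ge0 (dense_lincomb ed) (rinner_bounded_continuous Nb Ub)).
    by move=> _ [s _ <-]; rewrite rinnerNl /rinner hS oppr0.
  apply: (dense_ge0 (dense_lincomb ed) (rinner_bounded_continuous Sb Ub)).
  by move=> _ [s _ <-]; rewrite /rinner hS.
apply/eqP; rewrite -subr_eq0 -linearBl; apply/eqP.
have h0 s : inner (((tensor_op tau X Y - tensor_op tau Y X) \o U) (lincomb e s))
   (U (lincomb e s)) = 0.
  rewrite -[(_ \o _) _]/(tensor_op tau X Y (U (lincomb e s)) -
     tensor_op tau Y X (U (lincomb e s))).
  by apply/eqP; rewrite linearBl subr_eq0; apply/eqP/hs.
rewrite -[RHS](linear0l inner (0 : K)); apply: inner_rinner.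
  by rewrite (dle _ TUb h0) rinner_hnorm hnorm0 expr0n.
have iTUb : bounded_operator ('i%C *: ((tensor_op tau X Y - tensor_op tau Y X) \o U)).
  exact: bounded_operatorZ.
have := dle _ iTUb; rewrite -Im_inner /rinner linear0l /= linearZl_LR.
set z := inner _ (U x) => h; have : complex.Re ('i%C * z) = 0.
  apply: h => s; rewrite linearZl_LR; apply/eqP; rewrite mulf_eq0; apply/orP.
  by right; apply/eqP/h0.
by case: z {h} => a b /=; lra.
Qed.

End Diagonal.

(** * Bounded midpoint convex functions are convex *)

Section MidpointConvexity.
Context {R : realType}.

(* The excess over the chord vanishes at the endpoints, so midpoint convexity
   bounds it everywhere by half of its supremum. *)
Lemma midpoint_convex (f : R -> R) (M : R) :
  (forall x, 0 <= x <= 1 -> f x <= M) ->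
  (forall x y, 0 <= x <= 1 -> 0 <= y <= 1 ->
     f ((x + y) / 2) <= (f x + f y) / 2) ->
  forall x y l, 0 <= x <= 1 -> 0 <= y <= 1 -> 0 <= l <= 1 ->
    f ((1 - l) * x + l * y) <= (1 - l) * f x + l * f y.
Proof.
move=> fM fmid x y l x01 y01 l01.
pose p l := (1 - l) * x + l * y.
pose g l := f (p l) - ((1 - l) * f x + l * f y).
have pI u : 0 <= u <= 1 -> 0 <= p u <= 1.
  by rewrite /p; case/andP: x01 => x0 x1; case/andP: y01 => y0 y1 /andP[u0 u1]; nra.
pose S := [set g u | u in [set u : R | 0 <= u <= 1]].
have S0 : S !=set0 by exists (g 0), 0 => //=; rewrite lexx ler01.
have Sub : has_ubound S.
  exists (M + (`|f x| + `|f y|)) => _ [u /= u01 <-].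
  rewrite /g; apply: lerD; first exact/fM/pI.
  have hx := ler_norm (- f x); have hy := ler_norm (- f y).
  rewrite !normrN in hx hy; case/andP: u01 => u0 u1.
  have := normr_ge0 (f x); have := normr_ge0 (f y); nra.
pose B := sup S.
have gB u : 0 <= u <= 1 -> g u <= B by move=> u01; apply: ub_le_sup => //; exists u.
have gmid u v : 0 <= u <= 1 -> 0 <= v <= 1 -> g ((u + v) / 2) <= (g u + g v) / 2.
  move=> u01 v01; have := fmid _ _ (pI u u01) (pI v v01); rewrite /g.
  have -> : (p u + p v) / 2 = p ((u + v) / 2) by rewrite /p; field.
  by move: (f (p _)) (f (p _)) (f (p _)) => a b c; lra.
have g0 : g 0 = 0 by rewrite /g /p !(subr0, mul1r, mul0r, addr0) subrr.
have g1 : g 1 = 0 by rewrite /g /p !(subrr, mul1r, mul0r, add0r).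
(* Every [u] is the midpoint of an endpoint and a point of [[0, 1]]: of 0 and [2 u] if [u <= 1/2],
   of 1 and [2 u - 1] otherwise. *)
have half u : 0 <= u <= 1 -> g u <= B / 2.
  move=> /andP[u0 u1]; have [u2|u2] := leP u 2^-1.
    have h : 0 <= 2 * u <= 1 by apply/andP; split; lra.
    have := gmid 0 (2 * u) ltac:(by rewrite lexx ler01) h.
    rewrite (_ : (0 + 2 * u) / 2 = u); last by field.
    by have := gB _ h; rewrite g0; lra.
  have h : 0 <= 2 * u - 1 <= 1 by apply/andP; split; lra.
  have := gmid 1 (2 * u - 1) ltac:(by rewrite lexx ler01) h.
  rewrite (_ : (1 + (2 * u - 1)) / 2 = u); last by field.
  by have := gB _ h; rewrite g1; lra.
have B2 : B <= B / 2 by apply: sup_le_ub => // _ [u /= u01 <-]; apply: half.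
have : g l <= 0 by apply: le_trans (gB l l01) _; lra.
by rewrite /g /p subr_le0.
Qed.

End MidpointConvexity.

(** * Weighted geometric means as Gram products *)

Section GeometricMean.
Context {R : realType}.
Variables (H : hilbertType R) (A B : H -> H).
Hypotheses (Apos : posdef A) (Bpos : posdef B).

Let C := op_power A (- 2^-1) \o B \o op_power A (- 2^-1).

Lemma posdef_gmean_core : posdef C.
Proof.
apply: posdef_conjugate => //; first exact: op_power_bounded.
  exact: op_power_selfadjoint.
exact: op_power_bounded_below.
Qed.

Lemma gmean_bounded r : bounded_operator (gmean r A B).
Proof.
have h := op_power_bounded posdef_gmean_core r.
have ha := op_power_bounded Apos 2^-1.
by do 2?[apply: bounded_operator_comp => //].
Qed.

Definition gmean_factor (r : R) : H -> H := op_power C r \o op_power A 2^-1.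

Lemma inner_gmean_factor r s x y :
  inner (gmean_factor r x) (gmean_factor s y) = inner (gmean (r + s) A B x) y.
Proof.
rewrite /gmean /gmean_factor /= -/C (op_power_selfadjoint Apos).
rewrite -(op_power_selfadjoint posdef_gmean_core s).
by rewrite (op_powerD posdef_gmean_core) addrC.
Qed.

Lemma gmean_selfadjoint r : selfadjoint (gmean r A B).
Proof.
move=> x y; rewrite (_ : r = r / 2 + r / 2); last by rewrite -splitr.
by rewrite -inner_gmean_factor [RHS]innerC -inner_gmean_factor -innerC.
Qed.

Lemma gmean_factor_bound : exists2 M : R, 0 <= M &
  forall r, 0 <= r <= 1 -> opbound (gmean_factor r) M.
Proof.
have [M M0 hM] := op_power_uniform_bound posdef_gmean_core.
have /bounded_operatorP[_ [N N0 hN]] := op_power_bounded Apos 2^-1.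
exists (M * N) => [|r r01 x]; first by rewrite mulr_ge0 // ltW.
by apply: le_trans (hM r r01 _) _; rewrite -mulrA ler_wpM2l.
Qed.

End GeometricMean.

(** * Convexity of the form on the tensor square *)

Section TensorConvexity.
Context {R : realType}.
Variables (H K : hilbertType R) (tau : hilbert_tensor H H K).

Section Pair.
Variables (A B A' B' : H -> H).
Hypotheses (Apos : posdef A) (Bpos : posdef B).
Hypotheses (Apos' : posdef A') (Bpos' : posdef B').
Variable s : seq (R[i] * (H * H)).

Let w (a b : R) := tensor_lincomb tau (gmean_factor A B a) (gmean_factor A' B' b) s.

Lemma inner_gmean_tensor a b c d :
  inner (w a b) (w c d) =
  inner (tensor_lincomb tau (gmean (a + c) A B) (gmean (b + d) A' B') s)
        (tensor_lincomb tau id id s).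
Proof.
rewrite /w /tensor_lincomb !inner_lincomb.
apply: eq_bigr => p _; apply: eq_bigr => q _; congr (_ * _).
by rewrite !tensor_inner (inner_gmean_factor Apos) // (inner_gmean_factor Apos').
Qed.

(** The function [q_jk] for a fixed formal sum [s], with [A], [B] at index [j] and [A'], [B'] at
    index [k]. *)
Definition gmean_quad (r : R) : R := hnorm (w (r / 2) ((1 - r) / 2)) ^+ 2.

Lemma gmean_quadE r :
  inner (tensor_lincomb tau (gmean r A B) (gmean (1 - r) A' B') s)
        (tensor_lincomb tau id id s) = (gmean_quad r)%:C.
Proof. by rewrite /gmean_quad -inner_hnorm inner_gmean_tensor -!splitr. Qed.

(* [|u - v|^2 >= 0] for [u = w (x/2) ((1-x)/2)] and [v = w (y/2) ((1-y)/2)]: the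
   cross term [<u, v>] is the form at the midpoint, by the semigroup law of the
   powers. *)
Lemma gmean_quad_midpoint x y :
  gmean_quad ((x + y) / 2) <= (gmean_quad x + gmean_quad y) / 2.
Proof.
set u := w (x / 2) ((1 - x) / 2); set v := w (y / 2) ((1 - y) / 2).
have : rinner u v = gmean_quad ((x + y) / 2).
  rewrite /rinner inner_gmean_tensor.
  have -> : x / 2 + y / 2 = (x + y) / 2 by field.
  have -> : (1 - x) / 2 + (1 - y) / 2 = 1 - (x + y) / 2 by field.
  by rewrite gmean_quadE.
have : 0 <= hnorm (u - v) ^+ 2 by rewrite exprn_ge0 ?hnorm_ge0.
rewrite hnormB_sqr -[hnorm u ^+ 2]/(gmean_quad x) -[hnorm v ^+ 2]/(gmean_quad y).
move: (gmean_quad x) (gmean_quad y) (gmean_quad _) => a b c.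
by move=> h0 h1; rewrite h1 in h0; lra.
Qed.

Lemma gmean_quad_bounded : exists M : R, forall r, 0 <= r <= 1 -> gmean_quad r <= M.
Proof.
have [M M0 hM] := gmean_factor_bound Apos Bpos.
have [N N0 hN] := gmean_factor_bound Apos' Bpos'.
pose L : R := \sum_(z <- s) complex.Re `|z.1| * (M * hnorm z.2.1 * (N * hnorm z.2.2)).
exists (L ^+ 2) => r /andP[r0 r1].
rewrite /gmean_quad ler_pXn2r ?nnegrE ?hnorm_ge0 //; last first.
  apply: sumr_ge0 => z _; rewrite !mulr_ge0 ?hnorm_ge0 //.
  by rewrite -ler0c RRe_real ?normr_real.
rewrite /w /tensor_lincomb /lincomb /L.
elim/big_rec2: _ => [|z b v _ hb]; first by rewrite hnorm0.
apply: le_trans (hnorm_triangle _ _) _; apply: lerD => //.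
rewrite hnormZ tensor_hnorm ler_wpM2l //.
  by rewrite -ler0c RRe_real ?normr_real.
by apply: ler_pM; [exact: hnorm_ge0|exact: hnorm_ge0|apply: hM|apply: hN];
  apply/andP; split; lra.
Qed.

Lemma gmean_quad_convex x y l : 0 <= x <= 1 -> 0 <= y <= 1 -> 0 <= l <= 1 ->
  gmean_quad ((1 - l) * x + l * y) <= (1 - l) * gmean_quad x + l * gmean_quad y.
Proof.
have [M hM] := gmean_quad_bounded.
by apply: (midpoint_convex hM) => u v _ _; apply: gmean_quad_midpoint.
Qed.

End Pair.

Variables (n : nat) (A B : 'I_n -> H -> H).
Hypotheses (Apos : forall j, posdef (A j)) (Bpos : forall j, posdef (B j)).

Let G r : H -> H := \sum_(j < n) gmean r (A j) (B j).
Let T r := tensor_op tau (G r) (G (1 - r)).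

Lemma gmean_sum_bounded r : bounded_operator (G r).
Proof. by apply: bounded_operator_sum => j; apply: gmean_bounded. Qed.

Lemma gmean_sum_selfadjoint r : selfadjoint (G r).
Proof. by apply: selfadjoint_sum => j; apply: gmean_selfadjoint. Qed.

Lemma tensor_gmean_bounded r : bounded_operator (T r).
Proof.
exact: (tensor_opP tau (gmean_sum_bounded r) (gmean_sum_selfadjoint r)
  (gmean_sum_bounded (1 - r)) (gmean_sum_selfadjoint (1 - r))).1.
Qed.

Lemma tensor_sumE (P Q : 'I_n -> H -> H) x y :
  tau ((\sum_(j < n) P j) x) ((\sum_(k < n) Q k) y) =
  \sum_(j < n) \sum_(k < n) tau (P j x) (Q k y).
Proof.
have sE (F : 'I_n -> H -> H) z : (\sum_(j < n) F j) z = \sum_(j < n) F j z.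
  by elim/big_rec2: _ => // j a f _ <-.
rewrite !sE (linearf_sum (T := fun u => tau u _)); last exact: tensor_linear_l.
by apply: eq_bigr => j _; rewrite linearf_sum //; exact: tensor_linear_r.
Qed.

Lemma tensor_gmean_quad r s :
  inner (T r (tensor_lincomb tau id id s)) (tensor_lincomb tau id id s) =
  (\sum_(j < n) \sum_(k < n) gmean_quad (A j) (B j) (A k) (B k) s r)%:C.
Proof.
rewrite /T (tensor_opP tau (gmean_sum_bounded r) (gmean_sum_selfadjoint r)
  (gmean_sum_bounded (1 - r)) (gmean_sum_selfadjoint (1 - r))).2.
transitivity (\sum_(j < n) \sum_(k < n)
   inner (tensor_lincomb tau (gmean r (A j) (B j)) (gmean (1 - r) (A k) (B k)) s)
         (tensor_lincomb tau id id s)); last first.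
  rewrite rmorph_sum; apply: eq_bigr => j _.
  by rewrite rmorph_sum; apply: eq_bigr => k _; apply: gmean_quadE.
symmetry.
under eq_bigr => j _ do rewrite -linear_sumlz.
rewrite -linear_sumlz; congr (inner _ _).
rewrite /tensor_lincomb /lincomb.
under eq_bigr => j _ do rewrite exchange_big.
rewrite exchange_big; apply: eq_bigr => z _ /=.
under eq_bigr => j _ do rewrite -scaler_sumr.
by rewrite -scaler_sumr tensor_sumE.
Qed.

(** Density is used on the whole tensor square, because the vector [U x] at which the inequality is
    later read is in general only a limit of finite sums of elementary tensors. *)
Lemma tensor_gmean_convex x y l :
  0 <= x <= 1 -> 0 <= y <= 1 -> 0 <= l <= 1 ->
  positive_op ((1 - l)%:C *: T x + l%:C *: T y - T ((1 - l) * x + l * y)).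
Proof.
move=> x01 y01 l01.
apply: positive_op_dense (dense_lincomb (tensor_dense tau)) _.
  apply: bounded_operatorB; last exact: tensor_gmean_bounded.
  by apply: bounded_operatorD; apply: bounded_operatorZ; apply: tensor_gmean_bounded.
move=> _ [s _ <-].
rewrite -[lincomb _ s]/(tensor_lincomb tau id id s).
set v := tensor_lincomb tau id id s.
rewrite (inner_op_comb _ _ (tensor_gmean_quad x s) (tensor_gmean_quad y s)
  (tensor_gmean_quad _ s)).
rewrite -!rmorphM -rmorphD -rmorphB.
rewrite ler0c subr_ge0 !mulr_sumr -big_split; apply: ler_sum => j _ /=.
rewrite !mulr_sumr -big_split; apply: ler_sum => k _ /=.
exact: gmean_quad_convex.
Qed.

End TensorConvexity.

(** * From convexity on the tensor square to the Hadamard inequalities *)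

Theorem theorem3p3 (R : realType) (H HH : hilbertType R)
    (tau : hilbert_tensor H H HH)
    (J : Type) (e : J -> H) (he : orthonormal_basis e)
    (n : nat) (A B : 'I_n -> H -> H)
    (hA : forall j, [/\ bounded_operator (A j), positive_op (A j)
                      & invertible_op (A j)])
    (hB : forall j, [/\ bounded_operator (B j), positive_op (B j)
                      & invertible_op (B j)])
    (s t : R)
    (hst : [/\ t <= 1, s <= t & 2^-1 < s] \/ [/\ 0 <= t, t <= s & s < 2^-1]) :
  let G (r : R) : H -> H := \sum_(j < n) gmean r (A j) (B j) in
  let had (X Y : H -> H) : H -> H := hadamard tau e X Y in
  op_le (had (G s) (G (1 - s)))
        (had (G s) (G (1 - s))
         + ((t - s) / (s - 2^-1))%:C
             *: (had (G s) (G (1 - s)) - had (G 2^-1) (G 2^-1)))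
  /\
  op_le (had (G s) (G (1 - s))
         + ((t - s) / (s - 2^-1))%:C
             *: (had (G s) (G (1 - s)) - had (G 2^-1) (G 2^-1)))
        (had (G t) (G (1 - t))).
Proof.
move=> G had.
have Apos j : posdef (A j) := posdef_invertible (hA j).
have Bpos j : posdef (B j) := posdef_invertible (hB j).
have half01 : 0 <= (2^-1 : R) <= 1 by apply/andP; split; lra.
have [s01 t01 sn0] : [/\ 0 <= s <= 1, 0 <= t <= 1 & s - 2^-1 != 0].
  case: hst => -[h1 h2 h3]; split; try (apply/andP; split; lra).
    by rewrite gt_eqF // subr_gt0.
  by rewrite lt_eqF // subr_lt0.
(* In both ranges [t - s] and [s - 1/2] do not have opposite signs, so [c >= 0] and the two cases
   merge from here on. *)
set c : R := (t - s) / (s - 2^-1).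
have c0 : 0 <= c.
  case: hst => -[h1 h2 h3].
    by rewrite divr_ge0 // subr_ge0 // ltW.
  have -> : c = (s - t) / (2^-1 - s).
    by rewrite /c -(opprB s t) -(opprB 2^-1 s) invrN mulrNN.
  by rewrite divr_ge0 // subr_ge0 // ltW.
(* Since [1 + c = (t - 1/2) / (s - 1/2)], its inverse is the position of [s] on the segment from
   [1/2] to [t]. *)
pose l := (1 + c)^-1.
have c1 : 0 < 1 + c by rewrite ltr_wpDr.
have l01 : 0 <= l <= 1.
  by rewrite invr_ge0 (ltW c1) invf_le1 // lerDl.
have sE : (1 - l) * 2^-1 + l * t = s.
  have tE : t = s + c * (s - 2^-1) by rewrite /c divfK // addrC subrK.
  by rewrite /l tE; field; rewrite gt_eqF.
pose h x r := inner (had (G r) (G (1 - r)) x) x.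
have Gb r : bounded_operator (G r) := gmean_sum_bounded Apos Bpos r.
have Gs r : selfadjoint (G r) := gmean_sum_selfadjoint Apos Bpos r.
have hsym x r : h x (1 - r) = h x r.
  by rewrite /h subKr; apply: (inner_hadamardC tau he).
have hconv x r0 r1 m : 0 <= r0 <= 1 -> 0 <= r1 <= 1 -> 0 <= m <= 1 ->
    0 <= (1 - m)%:C * h x r0 + m%:C * h x r1 - h x ((1 - m) * r0 + m * r1).
  move=> r001 r101 m01.
  have := tensor_gmean_convex tau Apos Bpos r001 r101 m01
    (diagonal_isometry tau e x).
  have hE r := esym (inner_hadamard tau he (G r) (G (1 - r)) x).
  by rewrite (inner_op_comb _ _ (hE r0) (hE r1) (hE _)).
have h12 x : inner (had (G 2^-1) (G 2^-1) x) x = h x 2^-1.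
  by rewrite /h; congr (inner (had _ (G _) x) x); lra.
split=> x.
  have chordE (P Q : H -> H) p q : inner (P x) x = p -> inner (Q x) x = q ->
      inner ((P + c%:C *: (P - Q) - P) x) x = c%:C * (p - q).
    move=> <- <-; rewrite [P + _]addrC addrK -[(_ *: _) x]/(c%:C *: (P x - Q x)).
    by rewrite linearZl_LR linearBl.
  rewrite (chordE _ _ (h x s) _ erefl (h12 x)).
  rewrite mulr_ge0 ?ler0c //.
  have s'01 : 0 <= 1 - s <= 1 by case/andP: s01 => ? ?; apply/andP; split; lra.
  (* [1/2] is the midpoint of [s] and [1 - s], where [h x] takes equal values by symmetry. *)
  have := hconv x s (1 - s) 2^-1 s01 s'01 half01.
  have -> : (1 - 2^-1) * s + 2^-1 * (1 - s) = 2^-1 by field.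
  rewrite hsym -mulrDl -rmorphD subrK rmorph1 mul1r //.
have chordE (P Q S : H -> H) p q r :
    inner (P x) x = p -> inner (Q x) x = q -> inner (S x) x = r ->
    inner ((P - (Q + c%:C *: (Q - S))) x) x = p - (q + c%:C * (q - r)).
  move=> <- <- <-; rewrite -[(_ - _) x]/(P x - (Q x + c%:C *: (Q x - S x))).
  by rewrite linearBl linearDl linearZl_LR linearBl.
rewrite (chordE _ _ _ (h x t) (h x s) _ erefl erefl (h12 x)).
have := hconv x 2^-1 t l half01 t01 l01; rewrite sE.
(* Multiplying the chord inequality at [s] by [1 + c] gives [(1 + c) w <= c u + v], with [u], [v],
   [w] the values of [h x] at [1/2], [t], [s]; this is the claim rearranged. *)
have c1C : 0 <= (1 + c)%:C by rewrite ler0c ltW.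
move=> /(mulr_ge0 c1C).
have lc : (1 + c) * l = 1 by rewrite /l mulfV // gt_eqF.
have cl : (1 + c) * (1 - l) = c by rewrite mulrBr mulr1 lc addrC addKr.
move: (h x 2^-1) (h x t) (h x s) => u v w.
rewrite mulrBr mulrDr !mulrA -!rmorphM lc cl rmorphD rmorph1 mulrDl !mul1r mulrBr.
move: (c%:C * u) (c%:C * w) => cu cw.
by rewrite (addrC cu) (addrA w) opprB (addrA v).
Qed.
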